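(* Let $\mathcal{K}$ be a complex separable Hilbert space, let $N\subseteq H^2_{\mathcal{K}}$ be a model space such that $M:=H^2_{\mathcal{K}}\ominus N$ is full range, and let $W:=M\ominus S(M)$, $W_1:=W\ominus(W\cap\mathcal{K})$ and $\mathcal{K}_1:=\mathcal{K}\ominus(W\cap\mathcal{K})$. Let $\{E_j\}_{j\in J}$ be an orthonormal basis of $W_1$ and $\{e_j\}_{j\in J}$ an orthonormal basis of $\mathcal{K}_1$. Then $\{A_N^n(P_Ne_j)\}_{j\in J,\,n\geqslant0}$ and $\{(S^* )^nS^*E_j\}_{j\in J,\,n\geqslant0}$ are Parseval frames of $N$.
   Context: Let $\mathbb{T}$ be the unit circle with normalized Lebesgue measure. $H^2_{\mathcal{K}}\subseteq L^2(\mathbb{T},\mathcal{K})$ is the Hardy space of square-integrable $\mathcal{K}$-valued functions on $\mathbb{T}$ whose Fourier coefficients of negative index vanish; $\mathcal{K}$ is identified with the subspace of constant functions in $H^2_{\mathcal{K}}$. $S:H^2_{\mathcal{K}}\to H^2_{\mathcal{K}}$, $Sf(z)=zf(z)$, is the unilateral shift, with adjoint $S^*f(z)=(f(z)-f(0))/z$. A model space is a closed $S^*$-invariant subspace $N\subseteq H^2_{\mathcal{K}}$; $A_N:N\to N$, $A_Nf=P_NSf$, is the shift compression, with $P_N$ the orthogonal projection onto $N$. For a closed $S$-invariant subspace $M\subseteq H^2_{\mathcal{K}}$ and an orthonormal basis $\{F_i\}_i$ of $W=M\ominus S(M)$, set $J(z)=\overline{\mathrm{span}}\{F_i(z)\}_i\subseteq\mathcal{K}$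 for almost every $z\in\mathbb{T}$ (independent of the basis, up to null sets). $M$ is full range if $J(z)=\mathcal{K}$ for almost every $z$. Under the assumptions of the claim $\dim W_1=\dim\mathcal{K}_1$, so the two orthonormal bases may be indexed by the same set $J$. A countable family $\{x_k\}_k$ in a Hilbert space $N$ is a Parseval frame of $N$ if $\sum_k|\langle x,x_k\rangle|^2=\|x\|^2$ for all $x\in N$. *)

(* Defs.v *)
From HB Require Import structures.
From mathcomp Require Import all_boot all_order all_algebra sesquilinear complex.
From mathcomp Require Import all_classical all_reals all_analysis.

Set Implicit Arguments.
Unset Strict Implicit.
Unset Printing Implicit Defensive.

Import Order.TTheory GRing.Theory Num.Theory numFieldNormedType.Exports.

Local Open Scope classical_set_scope.
Local Open Scope ring_scope.

(* The inner product is linear in its first argument and conjugate-linear in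
   its second one. *)
HB.mixin Record NormedModule_isHilbert (R : realType) K
    of CompleteNormedModule R[i] K := {
  inner : {dot K for (@Num.conj R[i])} ;
  innerE : forall x : K, inner x x = `|x| ^+ 2
}.

#[short(type="hilbertType")]
HB.structure Definition Hilbert (R : realType) :=
  {K of NormedModule_isHilbert R K & CompleteNormedModule R[i] K}.

Definition separable_space (T : topologicalType) : Prop :=
  exists2 D : set T, countable D & dense D.

Definition lin_span (C : pzRingType) (V : lmodType C) (A : set V) : set V :=
  [set x | exists (n : nat) (a : 'I_n -> C) (v : 'I_n -> V),
      (forall i, A (v i)) /\ x = \sum_(i < n) a i *: v i].

(* Norms over R[i] take their values in R[i]; this is the same number in R. *)
Definition rnorm (R : realType) (V : normedZmodType R[i]) (x : V) : R :=
  complex.Re `|x|.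

Section circle.
Variable R : realType.

Definition circle : Type := {z : R[i] | `|z| == 1}.

Definition expi (t : R) : R[i] := (cos t +i* sin t)%C.

Lemma norm_expi (t : R) : `|expi t| == 1.
Proof. by rewrite normc_def /= cos2Dsin2 sqrtr1. Qed.

Definition cis (t : measurableTypeR R) : circle := exist _ (expi t) (norm_expi t).

HB.instance Definition _ := Choice.on circle.
HB.instance Definition _ := isPointed.Build circle (cis 0).

(* The quotient sigma-algebra of t |-> e^{it}: it consists of the Borel subsets
   of the circle, because that map is continuous on R and is a Borel
   isomorphism of [0, 2 pi[ onto the circle. *)
Definition circle_measurable : set (set circle) :=
  [set A | measurable (cis @^-1` A)].

Lemma circle_measurable0 : circle_measurable set0.
Proof. by rewrite /circle_measurable /= preimage_set0. Qed.

Lemma circle_measurableC A : circle_measurable A -> circle_measurable (~` A).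
Proof.
by move=> mA; rewrite /circle_measurable /= preimage_setC; exact: measurableC.
Qed.

Lemma circle_measurable_bigcup (F : (set circle)^nat) :
  (forall i, circle_measurable (F i)) -> circle_measurable (\bigcup_i F i).
Proof.
move=> mF; rewrite /circle_measurable /= preimage_bigcup.
exact: bigcupT_measurable.
Qed.

HB.instance Definition _ := @isMeasurable.Build default_measure_display circle
  circle_measurable circle_measurable0 circle_measurableC
  circle_measurable_bigcup.

Lemma measurable_cis : measurable_fun [set: measurableTypeR R] cis.
Proof. by move=> _ A mA; rewrite setTI. Qed.

HB.instance Definition _ := isMeasurableFun.Build _ _ _ _ cis measurable_cis.

Lemma two_pi_gt0 : 0 < pi *+ 2 :> R.
Proof. by rewrite pmulrn_lgt0 // pi_gt0. Qed.

(* Normalized Lebesgue measure: the image by t |-> e^{it} of the uniform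
   probability dt / (2 pi) on [0, 2 pi]. *)
Definition arc_measure : probability circle R :=
  distribution (uniform_prob two_pi_gt0) cis.

Definition cintegral (g : circle -> R[i]) : R[i] :=
  ((\int[arc_measure]_z complex.Re (g z)) +i*
   (\int[arc_measure]_z complex.Im (g z)))%C.

End circle.

(* Elements of L^2 are represented by functions, with no quotient by equality
   almost everywhere.  All notions below are insensitive to modifications on a
   null set (that keep the function measurable). *)
Section hardy.
Variables (R : realType) (K : hilbertType R).
Local Notation T := (circle R).
Local Notation mu := (arc_measure R).
Implicit Types (f g : T -> K) (N M U V : set (T -> K)).

Definition borel_fun f := forall O : set K, open O -> measurable (f @^-1` O).

Definition L2 : set (T -> K) :=
  [set f | borel_fun f /\ (\int[mu]_z (rnorm (f z) ^+ 2)%:E < +oo)%E].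

Definition l2inner f g : R[i] := cintegral (fun z => inner (f z) (g z)).

Definition l2norm f : R := Num.sqrt (\int[mu]_z (rnorm (f z) ^+ 2)).

(* [c] is the weak integral of z |-> z^{-n} f(z). *)
Definition is_fourier_coef f (n : int) (c : K) : Prop :=
  forall k : K,
    inner c k = cintegral (fun z => inner ((val z ^ (- n)) *: f z) k).

(* For f in L^2 the coefficient exists and is unique, by the Riesz
   representation theorem; the default value 0 is then never used. *)
Definition fourier_coef f (n : int) : K :=
  xget 0 [set c | is_fourier_coef f n c].

Definition H2 : set (T -> K) :=
  [set f | L2 f /\ forall n : int, n < 0 -> is_fourier_coef f n 0].

Definition unilateral_shift f : T -> K := fun z => val z *: f z.

(* The value f(0) of the holomorphic extension to the disc is the Fourier
   coefficient of index 0. *)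
Definition backward_shift f : T -> K :=
  fun z => (val z)^-1 *: (f z - fourier_coef f 0).

Definition l2closure V : set (T -> K) :=
  [set f | L2 f /\ forall eps : R, 0 < eps ->
      exists2 g, V g & l2norm (f - g) < eps].

Definition closed_subspace V : Prop :=
  [/\ V `<=` H2, V 0,
      forall (a : R[i]) f g, V f -> V g -> V (a *: f + g)
    & l2closure V `<=` V].

Definition model_space N : Prop :=
  closed_subspace N /\ forall f, N f -> N (backward_shift f).

(* V (-) U *)
Definition ominus V U : set (T -> K) :=
  [set f | V f /\ forall g, U g -> l2inner f g = 0].

(* The default value 0 is not used when V is a closed subspace and f is in
   H2. *)
Definition orth_proj V f : T -> K :=
  xget 0 [set g | V g /\ forall h, V h -> l2inner (f - g) h = 0].

Definition compression N f : T -> K := orth_proj N (unilateral_shift f).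

Definition constants : set (T -> K) :=
  [set f | H2 f /\ exists k : K, {ae mu, forall z, f z = k}].

Definition orthonormal_basis (I : choiceType) (F : I -> T -> K) V : Prop :=
  [/\ forall i, V (F i),
      forall i j, l2inner (F i) (F j) = (i == j)%:R
    & V `<=` l2closure (lin_span (range F))].

Definition wandering M : set (T -> K) := ominus M (unilateral_shift @` M).

Definition pointwise_range (I : Type) (F : I -> T -> K) (z : T) : set K :=
  closure (lin_span (range (fun i => F i z))).

(* Up to null sets the pointwise range does not depend on the orthonormal
   basis, and orthonormal families are countable when K is separable. *)
Definition full_range M : Prop :=
  exists (I : countType) (F : I -> T -> K),
    orthonormal_basis F (wandering M) /\
    {ae mu, forall z, pointwise_range F z = [set: K]}.

Definition parseval_frame (I : choiceType) (x : I -> T -> K) N : Prop :=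
  [/\ countable [set: I],
      forall i, N (x i)
    & forall f, N f ->
        \esum_(i in [set: I]) (rnorm (l2inner f (x i)) ^+ 2)%:E
        = (l2norm f ^+ 2)%:E].

End hardy.

Arguments H2 {R} K.
Arguments constants {R} K.

(* Main.v *)
Require Import Defs.
From HB Require Import structures.
From mathcomp Require Import all_boot all_order all_algebra sesquilinear complex.
From mathcomp Require Import ring lra zify.
From mathcomp Require Import all_classical all_reals all_analysis.
From mathcomp Require Import measurable_realfun lebesgue_integral_differentiation.

(** Multiplication by z^n is unitary on the space L2 of square-integrable functions
with values in K, and two families of subspaces split L2 along its powers: the
shifts z^n K of the constants, and the shifts z^n W of the wandering subspace W
of M, the orthocomplement of N in H2.  In both families, shifts by distinct
powers are orthogonal ([constants_zshift_orth], [wandering_zshift_orth]).  Both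
exhaust L2, for the same reason ([shifts_total]): if g is orthogonal to all the
shifts of A_0, A_1, ..., then each scalar function z |-> <g(z), A_i(z)> has no
Fourier coefficient, so it vanishes almost everywhere ([fourier_null_ae]), and
g(z) = 0 as soon as the A_i(z) span a dense subspace of K.  For the constants
the A_i run through a dense sequence of K; for W they are an orthonormal basis,
and this is where full range is used.

Let f be in N.  As f is in H2, it is orthogonal to z^n k for n < 0 and k
constant; as it is orthogonal to M, it is orthogonal to z^n w for n >= 0 and w
in W.  Expanding f along the shifts of W thus leaves the negative powers only,
and among these the constant elements of W contribute nothing: there remain the
vectors z^(-n-1) E_j.  Expanding f along the shifts of K leaves the nonnegative
powers, to which the elements of K that lie in W contribute nothing: there
remain the vectors z^n e_j.  Hence

    |f|^2 = sum_(j, n) |<f, z^(-n-1) E_j>|^2 = sum_(j, n) |<f, z^n e_j>|^2.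

Both equalities are instances of [wandering_parseval].  It remains to see that
the vectors of the theorem have these coefficients against f: the backward shift
is the adjoint of the shift on H2 ([backward_shift_adj]), and z^n e_j and
A_N^n (P_N e_j) differ by a vector orthogonal to N ([iter_compressionP]).  The
index set is countable because every E_j has a nonzero coefficient on a
countable orthonormal basis of W ([orthonormal_countable]).

The space L2 consists of functions rather than of classes, so it only carries a
semi-inner product; a closed subspace is closed under modification on a null
set, and equalities in L2 take the form of a vanishing norm.  The analytic
facts behind the argument are the equivalence of weak and Borel measurability in
a separable space ([wmeasurable_borel]), the existence of orthogonal projections
([projection_exists]), which rests on the completeness of L2, and the uniqueness
of Fourier coefficients for integrable functions, for which the density of
trigonometric polynomials is replaced by an explicit polynomial approximation of
the indicators of arcs ([multiplier_arc]). *)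

Set Implicit Arguments.
Unset Strict Implicit.
Unset Printing Implicit Defensive.
Import Order.TTheory GRing.Theory Num.Theory numFieldNormedType.Exports.
Local Open Scope classical_set_scope.
Local Open Scope ring_scope.

(** * Complex numbers and inner products *)

Section Complex.
Variable R : realType.
Implicit Types (a b : R[i]).

Lemma cReD a b : complex.Re (a + b) = complex.Re a + complex.Re b.
Proof. by case: a b => ? ? []. Qed.

Lemma cImD a b : complex.Im (a + b) = complex.Im a + complex.Im b.
Proof. by case: a b => ? ? []. Qed.

Lemma cReM a b : complex.Re (a * b) = complex.Re a * complex.Re b - complex.Im a * complex.Im b.
Proof. by case: a b => ? ? []. Qed.

Lemma cImM a b : complex.Im (a * b) = complex.Re a * complex.Im b + complex.Im a * complex.Re b.
Proof. by case: a b => ? ? [] ? ? //=; rewrite addrC. Qed.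

Lemma cRe_conj a : complex.Re (Num.conj a) = complex.Re a.
Proof. by case: a. Qed.

Lemma cIm_conj a : complex.Im (Num.conj a) = - complex.Im a.
Proof. by case: a. Qed.

Lemma complex_ext a b : complex.Re a = complex.Re b -> complex.Im a = complex.Im b -> a = b.
Proof. by case: a b => ? ? [? ?] /= -> ->. Qed.

Lemma rnormE (V : normedZmodType R[i]) (x : V) : `|x| = (rnorm x)%:C%C.
Proof. by rewrite /rnorm RRe_real// normr_real. Qed.

Lemma rnorm_sqC a : rnorm a ^+ 2 = complex.Re a ^+ 2 + complex.Im a ^+ 2.
Proof.
by apply: complexI; rewrite add_Re2_Im2 -[in RHS]/(`|a|) rnormE rmorphXn.
Qed.

Lemma rnorm_ge0 (V : normedZmodType R[i]) (x : V) : 0 <= rnorm x.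
Proof. by rewrite -ler0c -rnormE. Qed.

Lemma rnormD (V : normedZmodType R[i]) (x y : V) : rnorm (x + y) <= rnorm x + rnorm y.
Proof. by rewrite -lecR rmorphD/= -!rnormE ler_normD. Qed.

Lemma rnormN (V : normedZmodType R[i]) (x : V) : rnorm (- x) = rnorm x.
Proof. by rewrite /rnorm normrN. Qed.

Lemma rnorm0 (V : normedZmodType R[i]) : rnorm (0 : V) = 0.
Proof. by rewrite /rnorm normr0. Qed.

Lemma rnorm_eq0 (V : normedZmodType R[i]) (x : V) : rnorm x = 0 -> x = 0.
Proof. by move=> h; apply/eqP; rewrite -normr_eq0 rnormE h. Qed.

Lemma rnormZ (V : normedModType R[i]) a (x : V) : rnorm (a *: x) = rnorm a * rnorm x.
Proof. by apply: complexI; rewrite rmorphM/= -!rnormE normrZ. Qed.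

Lemma rnormM (a b : R[i]) : rnorm (a * b) = rnorm a * rnorm b.
Proof. by apply: complexI; rewrite rmorphM/= -!rnormE normrM. Qed.

Lemma rnormC (x : R) : rnorm (x%:C)%C = `|x|.
Proof. by rewrite /rnorm normc_def/= expr0n/= addr0 sqrtr_sqr. Qed.

Lemma Re_le_rnorm a : `|complex.Re a| <= rnorm a.
Proof. by rewrite -lecR -rnormE; exact: normc_ge_Re. Qed.

Lemma Im_le_rnorm (a : R[i]) : `|complex.Im a| <= rnorm a.
Proof.
rewrite -(@ler_pXn2r _ 2)// ?nnegrE ?rnorm_ge0 ?normr_ge0//.
by rewrite rnorm_sqC real_normK ?num_real// lerDr sqr_ge0.
Qed.

(** Restricted to the real multiples of a, the form is a real quadratic
polynomial.  Only its values enter, so that the lemma applies to a Hilbert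
space, to L2 with its seminorm and, with p = 0, to the variation of a distance
around its minimum. *)
Lemma quad_form_ge0 (p q : R) (a : R[i]) : 0 <= q ->
  (forall c, 0 <= p - 2 * complex.Re (Num.conj c * a) + rnorm c ^+ 2 * q) ->
  rnorm a ^+ 2 <= p * q.
Proof.
move=> q0 h; have p0 : 0 <= p.
  by have := h 0; rewrite rmorph0 mul0r rnorm0 expr0n/= mul0r mulr0 subr0 addr0.
set n := rnorm a ^+ 2.
have ht t : 0 <= p - 2 * (t * n) + t ^+ 2 * n * q.
  have := h (t%:C%C * a); rewrite !rnorm_sqC.
  suff -> : complex.Re (Num.conj (t%:C%C * a) * a) = t * n.
    by rewrite /n rnorm_sqC; case: a {h n} => b c /= h; nra.
  by rewrite /n rnorm_sqC; case: a {h n} => b c /=; ring.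
have n0 : 0 <= n by exact: sqr_ge0.
have [nz|np] := eqVneq n 0; first by rewrite nz mulr_ge0.
have {n0}np : 0 < n by rewrite lt_neqAle eq_sym np.
(* A form without quadratic term is negative at t = (p+1)/n; otherwise the
   minimum is at t = 1/q. *)
have [qz|qp] := eqVneq q 0.
  have := ht ((p + 1) / n); rewrite qz !mulr0 divfK ?gt_eqF//; nra.
have {q0}qp : 0 < q by rewrite lt_neqAle eq_sym qp.
have := ht q^-1.
have -> : p - 2 * (q^-1 * n) + q^-1 ^+ 2 * n * q = p - n / q by field; rewrite gt_eqF.
by rewrite subr_ge0 ler_pdivrMr.
Qed.

End Complex.

Section Hilbert.
Variables (R : realType) (K : hilbertType R).
Implicit Types (x y k : K) (a : R[i]).

Lemma innerDl x y k : inner (x + y) k = inner x k + inner y k.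
Proof. exact: linearDl. Qed.

Lemma innerDr k x y : inner k (x + y) = inner k x + inner k y.
Proof. exact: linearDr. Qed.

Lemma innerNl x y : inner (- x) y = - inner x y.
Proof. exact: linearNl. Qed.

Lemma innerNr x y : inner x (- y) = - inner x y.
Proof. exact: linearNr. Qed.

Lemma inner0l x : inner 0 x = 0.
Proof. exact: linear0l. Qed.

Lemma innerZl a x y : inner (a *: x) y = a * inner x y.
Proof. exact: linearZl_LR. Qed.

Lemma innerZr a x y : inner x (a *: y) = Num.conj a * inner x y.
Proof. exact: linearZr_LR. Qed.

Lemma innerC x y : inner x y = Num.conj (inner y x).
Proof.
by have := hermC (inner : {dot K for (@Num.conj R[i])}) x y; rewrite expr0 mul1r.
Qed.

Lemma Im_inner x y : complex.Im (inner x y) = complex.Re (inner x ('i%C *: y)).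
Proof. by rewrite innerZr; case: (inner x y) => a b /=; rewrite !mul0r mulN1r opprK add0r. Qed.

Lemma inner_self x : inner x x = (rnorm x ^+ 2)%:C%C.
Proof. by rewrite innerE rnormE rmorphXn. Qed.

Lemma rnormBZ_sq a x y : rnorm (x - a *: y) ^+ 2 =
  rnorm x ^+ 2 - 2 * complex.Re (Num.conj a * inner x y) + rnorm a ^+ 2 * rnorm y ^+ 2.
Proof.
apply: complexI; rewrite -inner_self.
rewrite innerDl !innerDr !innerNl !innerNr !innerZl !innerZr !inner_self.
rewrite (innerC y x); case: (inner x y) => u v; rewrite rnorm_sqC.
by apply: complex_ext; case: a => b c /=; ring.
Qed.

Lemma inner_CS x y : rnorm (inner x y) <= rnorm x * rnorm y.
Proof.
rewrite -(@ler_pXn2r _ 2)// ?nnegrE ?mulr_ge0 ?rnorm_ge0// exprMn.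
apply: quad_form_ge0 => [|c]; first exact: sqr_ge0.
by rewrite -rnormBZ_sq sqr_ge0.
Qed.

Lemma Re_inner_le x y : complex.Re (inner x y) <= rnorm x * rnorm y.
Proof.
by apply: le_trans (inner_CS x y); apply: le_trans (ler_norm _) (Re_le_rnorm _).
Qed.

(** Through this identity the measurability of an inner product follows from that
of norms. *)
Lemma polarization x y :
  4 * complex.Re (inner x y) = rnorm (x + y) ^+ 2 - rnorm (x - y) ^+ 2.
Proof.
have h (z : K) : rnorm z ^+ 2 = complex.Re (inner z z) by rewrite inner_self.
rewrite !h !innerDl !innerDr !innerNl !innerNr !cReD.
rewrite (innerC y x); case: (inner x y) (inner x x) (inner y y) => [? ?] [? ?] [? ?] /=; ring.
Qed.

Definition dense_seq (d : nat -> K) :=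
  forall x (e : R), 0 < e -> exists n, rnorm (x - d n) < e.

(** An enumeration of the dense set, so that suprema and unions can be indexed by
natural numbers. *)
Lemma separable_dense_seq : separable_space K -> exists d : nat -> K, dense_seq d.
Proof.
move=> [D /countable_injP [f finj] dD].
pose d n := xget 0 [set x | D x /\ f x = n].
exists d => x e e0.
have [||y [yb Dy]] := dD (ball x e%:C%C).
- by exists x; apply: ballxx; rewrite ltcR.
- exact: ball_open.
exists (f y).
have -> : d (f y) = y.
  rewrite /d; case: xgetP => [z _ [Dz /= fz]|/(_ y)]; last by case.
  by apply: finj; rewrite ?inE.
by move: yb; rewrite -ball_normE/= rnormE ltcR.
Qed.

(** Testing against the members of the sequence that approximate x gives
|x|^2 <= r |x| in the limit. *)
Lemma rnorm_le_dense (d : nat -> K) x (r : R) : dense_seq d -> 0 <= r ->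
  (forall n, complex.Re (inner x (d n)) <= r * rnorm (d n)) -> rnorm x <= r.
Proof.
move=> dd r0 h; have [->|xn0] := eqVneq x 0; first by rewrite rnorm0.
have x0 : 0 < rnorm x.
  rewrite lt_neqAle rnorm_ge0 andbT eq_sym; apply: contra xn0 => /eqP.
  by move=> /rnorm_eq0 ->.
apply/ler_addgt0Pr => e e0.
have [|n xd] := dd x (e * rnorm x / (r + rnorm x)).
  by rewrite divr_gt0 ?mulr_gt0 ?ltr_wpDl.
have rx : 0 < r + rnorm x by rewrite ltr_wpDl.
rewrite -(ler_pM2r x0) -expr2.
have -> : rnorm x ^+ 2 = complex.Re (inner x (d n)) + complex.Re (inner x (x - d n)).
  by rewrite -cReD -innerDr addrC subrK inner_self.
have dn : rnorm (d n) <= rnorm x + rnorm (x - d n).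
  by rewrite -{1}(subKr x (d n)) (le_trans (rnormD _ _))// rnormN.
move: (h n) (Re_inner_le x (x - d n)) => h1 h2.
move: xd; rewrite ltr_pdivlMr// => xd.
have := ler_wpM2l r0 dn; nra.
Qed.

Lemma orth_closure (S : set K) (y x : K) : (forall s, S s -> inner y s = 0) ->
  closure S x -> inner y x = 0.
Proof.
move=> yS cx; apply: rnorm_eq0; apply/eqP; rewrite eq_le rnorm_ge0 andbT.
apply/ler_addgt0Pr => e e0; rewrite add0r.
have y0 : 0 < rnorm y + 1 by rewrite ltr_wpDl ?rnorm_ge0.
have [|s [Ss]] := cx (ball x (e / (rnorm y + 1))%:C%C).
  by apply: nbhsx_ballx; rewrite ltcR divr_gt0.
rewrite -ball_normE/= rnormE ltcR ltr_pdivlMr// => h.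
have -> : inner y x = inner y (x - s) by rewrite innerDr innerNr (yS _ Ss) subr0.
apply: le_trans (inner_CS _ _) _; apply: le_trans (ltW h).
by rewrite mulrC ler_wpM2l ?rnorm_ge0// lerDl.
Qed.

Lemma lin_span_sub (V : lmodType R[i]) (A : set V) : A `<=` lin_span A.
Proof.
move=> x Ax; exists 1%N, (fun=> 1), (fun=> x); split => //.
by rewrite big_ord1 scale1r.
Qed.

Lemma lin_spanP (V : lmodType R[i]) (A : set V) (a : R[i]) (x y : V) :
  lin_span A x -> lin_span A y -> lin_span A (a *: x + y).
Proof.
move=> [n [b [v [Av ->]]]] [m [c [w [Aw ->]]]].
exists (n + m)%N, (fun i => match fintype.split i with inl j => a * b j | inr j => c j end),
  (fun i => match fintype.split i with inl j => v j | inr j => w j end).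
split; first by move=> i; case: fintype.split.
rewrite big_split_ord /= scaler_sumr; congr (_ + _); apply: eq_bigr => i _.
  by rewrite (unsplitK (inl i)) scalerA.
by rewrite (unsplitK (inr i)).
Qed.

Lemma orth_lin_span (S : set K) (y x : K) : (forall s, S s -> inner y s = 0) ->
  lin_span S x -> inner y x = 0.
Proof.
move=> yS [n [a [v [Sv ->]]]]; rewrite linear_sumr big1// => i _.
by apply: etrans (innerZr _ _ _) _; rewrite yS// mulr0.
Qed.

(** The norm of K has complex values; completeness is reached from real bounds on
the increments. *)
Lemma rnorm_summable_cvg (x : nat -> K) (b : R) :
  (forall n, \sum_(0 <= k < n) rnorm (x k.+1 - x k) <= b) -> cvgn x.
Proof.
move=> hb; pose v n := \sum_(0 <= k < n) rnorm (x k.+1 - x k).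
have vnd : nondecreasing_seq v.
  by apply/nondecreasing_seqP => n; rewrite /v big_nat_recr//= lerDl rnorm_ge0.
have vc : cvgn v.
  by apply: nondecreasing_is_cvgn => //; exists b => _ [n _ <-]; exact: hb.
have dist n p : rnorm (x (n + p)%N - x n) <= v (n + p)%N - v n.
  elim: p => [|p ih]; first by rewrite addn0 !subrr rnorm0.
  rewrite addnS /v big_nat_recr//= -/(v (n + p)%N).
  have -> : x (n + p).+1 - x n = (x (n + p).+1 - x (n + p)%N) + (x (n + p)%N - x n).
    by rewrite addrA subrK.
  apply: le_trans (rnormD _ _) _.
  by rewrite [v _ + _]addrC -addrA lerD2l.
apply/cauchy_cvgP; apply: cauchy_exP => e e0.
have e0' : 0 < complex.Re e by move: e0; rewrite ltcE => /andP[].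
have ee : e = (complex.Re e)%:C%C.
  by apply: complex_ext => //=; move: e0; rewrite ltcE /= => /andP[/eqP].
have /cvgrPdist_lt/(_ _ e0')[N _ hN] := vc.
exists (x N); exists N => // n /= Nn.
rewrite -ball_normE/= ee rnormE ltcR -opprB rnormN -(subnKC Nn).
apply: le_lt_trans (dist _ _) _; rewrite subnKC//.
have := hN N (leqnn _); rewrite ger0_norm ?subr_ge0 ?nondecreasing_cvgn_le//.
by apply: le_lt_trans; rewrite lerD2r nondecreasing_cvgn_le.
Qed.

Lemma cvgn_rnorm (x : nat -> K) : cvgn x -> rnorm (x n - limn x) @[n --> \oo] --> (0 : R).
Proof.
move=> xc; apply/cvgrPdist_lt => e e0.
have /cvgrPdist_lt/(_ e%:C%C) := xc; rewrite ltcR => /(_ e0); apply: filterS => n.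
by rewrite rnormE ltcR sub0r normrN ger0_norm ?rnorm_ge0// -rnormN opprB.
Qed.

End Hilbert.

(** * Integration over the circle *)

Section CircleIntegral.
Variable R : realType.
Local Notation T := (circle R).
Local Notation mu := (arc_measure R).
Local Notation leb := (@lebesgue_measure R).
Local Notation twopi := (pi *+ 2 : R).
Implicit Types (h : T -> R[i]).

(** Componentwise, like the integral. *)
Definition cmeasurable h := measurable_fun setT (fun z => complex.Re (h z)) /\
  measurable_fun setT (fun z => complex.Im (h z)).

Lemma cmeasurableM h h' : cmeasurable h -> cmeasurable h' -> cmeasurable (fun z => h z * h' z).
Proof.
move=> [a b] [a' b']; split.
  under eq_fun do rewrite cReM; apply: measurable_funB; exact: measurable_funM.
under eq_fun do rewrite cImM; apply: measurable_funD; exact: measurable_funM.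
Qed.

Lemma cmeasurable_cst (a : R[i]) : cmeasurable (fun=> a).
Proof. by split; exact: measurable_cst. Qed.

Definition rintegrable (u : T -> R) := mu.-integrable setT (EFin \o u).

Lemma rintegrableD (u v : T -> R) : rintegrable u -> rintegrable v ->
  rintegrable (fun z => u z + v z).
Proof. by move=> a b; exact: (integrableD measurableT a b). Qed.

Lemma rintegrableB (u v : T -> R) : rintegrable u -> rintegrable v ->
  rintegrable (fun z => u z - v z).
Proof. by move=> a b; exact: (integrableB measurableT a b). Qed.

Lemma rintegrableZ (r : R) (u : T -> R) : rintegrable u -> rintegrable (fun z => r * u z).
Proof. by move=> a; exact: (integrableZl measurableT r a). Qed.

Lemma rintegrable_le (u v : T -> R) : measurable_fun setT u -> (forall z, `|u z| <= v z) ->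
  rintegrable v -> rintegrable u.
Proof.
move=> mu_ uv; apply: (@le_integrable _ _ _ mu) => //; first exact/measurable_EFinP.
by move=> z _ /=; rewrite lee_fin (le_trans (uv z))// ler_norm.
Qed.

Definition cintegrable h := rintegrable (fun z => complex.Re (h z)) /\
  rintegrable (fun z => complex.Im (h z)).

Lemma cintegrableD h h' : cintegrable h -> cintegrable h' -> cintegrable (fun z => h z + h' z).
Proof.
move=> [a b] [a' b']; split.
  by under eq_fun do rewrite cReD; exact: rintegrableD.
by under eq_fun do rewrite cImD; exact: rintegrableD.
Qed.

Lemma cintegralD h h' : cintegrable h -> cintegrable h' ->
  cintegral (fun z => h z + h' z) = cintegral h + cintegral h'.
Proof.
move=> [a b] [a' b']; rewrite /cintegral; apply: complex_ext => /=.
  under eq_Rintegral do rewrite cReD; exact: RintegralD.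
under eq_Rintegral do rewrite cImD; exact: RintegralD.
Qed.

Lemma cintegrableZ (c : R[i]) h : cintegrable h -> cintegrable (fun z => c * h z).
Proof.
move=> [a b]; split.
  by under eq_fun do rewrite cReM; apply: rintegrableB; exact: rintegrableZ.
by under eq_fun do rewrite cImM; apply: rintegrableD; exact: rintegrableZ.
Qed.

Lemma cintegralZ (c : R[i]) h : cintegrable h ->
  cintegral (fun z => c * h z) = c * cintegral h.
Proof.
move=> [a b]; rewrite /cintegral; apply: complex_ext => /=.
  under eq_Rintegral do rewrite cReM.
  by rewrite cReM/= RintegralB ?RintegralZl//; exact: rintegrableZ.
under eq_Rintegral do rewrite cImM.
by rewrite cImM/= RintegralD ?RintegralZl//; exact: rintegrableZ.
Qed.

Lemma cintegral_conj h : cintegrable h ->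
  cintegral (fun z => Num.conj (h z)) = Num.conj (cintegral h).
Proof.
move=> [a b]; rewrite /cintegral; apply: complex_ext => /=.
  by apply: eq_Rintegral => z _; rewrite cRe_conj.
under eq_Rintegral do rewrite cIm_conj -mulN1r.
by rewrite RintegralZl// mulN1r.
Qed.

Lemma Rintegral_arc_cst (c : R) : \int[mu]_z c = c.
Proof.
rewrite (@Rintegral_cst _ _ _ mu)//; have e := probability_setT mu.
by rewrite [X in fine X]e mulr1.
Qed.

Lemma rnorm_val (z : T) : rnorm (val z) = 1.
Proof. by rewrite /rnorm (eqP (valP z)). Qed.

Lemma val_neq0 (z : T) : val z != 0.
Proof. by rewrite -normr_eq0 (eqP (valP z)) oner_eq0. Qed.

Lemma normr_valX (z : T) (n : int) : `|val z ^ n| = 1.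
Proof.
case: n => n; first by rewrite -exprnP normrX (eqP (valP z)) expr1n.
by rewrite NegzE -exprnN normfV normrX (eqP (valP z)) expr1n invr1.
Qed.

Lemma rnorm_valX (z : T) (n : int) : rnorm (val z ^ n) = 1.
Proof. by rewrite /rnorm normr_valX. Qed.

Lemma conj_val (z : T) : Num.conj (val z) = (val z)^-1.
Proof. by rewrite [RHS]invc_norm (eqP (valP z)) expr1n invr1 mul1r. Qed.

Lemma conj_valX (z : T) (n : int) : Num.conj (val z ^ n) = val z ^ (- n).
Proof.
by rewrite -invr_expz [RHS]invc_norm normr_valX expr1n invr1 mul1r.
Qed.

Lemma expiD (s t : R) : expi (s + t) = expi s * expi t.
Proof.
rewrite /expi cosD sinD; apply: complex_ext => //=; ring.
Qed.

Lemma expi_exprz (t : R) (n : int) : expi t ^ n = expi (n%:~R * t).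
Proof.
have hn (m : nat) : expi t ^+ m = expi (m%:R * t).
  elim: m => [|m ih]; first by rewrite expr0 mul0r /expi cos0 sin0.
  by rewrite exprS ih -expiD -[in RHS]natr1 mulrDl mul1r addrC.
case: n => n; first by rewrite -exprnP hn.
rewrite NegzE -exprnN hn rmorphN/= mulNr.
rewrite invc_norm (eqP (norm_expi _)) expr1n invr1 mul1r.
by apply: complex_ext; rewrite /= ?cosN ?sinN.
Qed.

(** The sigma-algebra of the circle is the quotient one, so measurability is
tested on the angular parameter. *)
Lemma circle_measurable_fun (u : T -> R) :
  measurable_fun setT (u \o @cis R) -> measurable_fun setT u.
Proof.
by move=> mu_ _ A mA; rewrite setTI; have := mu_ measurableT A mA; rewrite setTI.
Qed.

Lemma cmeasurable_valX (n : int) : cmeasurable (fun z : T => val z ^ n).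
Proof.
have mn : measurable_fun setT (fun t : R => n%:~R * t) by exact: measurable_funM.
split; apply: circle_measurable_fun; rewrite /comp/=;
  under eq_fun do rewrite expi_exprz/=.
  exact: (measurableT_comp (continuous_measurable_fun (@continuous_cos R)) mn).
exact: (measurableT_comp (continuous_measurable_fun (@continuous_sin R)) mn).
Qed.

Lemma ge0_integral_circle (f : T -> \bar R) : measurable_fun setT f -> (forall z, 0 <= f z)%E ->
  (\int[mu]_z f z = (twopi)^-1%:E * \int[leb]_(t in `[0%R, (twopi)%R]) f (cis t))%E.
Proof.
move=> mf f0; rewrite ge0_integral_distribution//.
rewrite (integral_uniform (two_pi_gt0 R))//; first by rewrite subr0.
by move=> t; exact: f0.
Qed.

Lemma rintegrable_circle (u : T -> R) : rintegrable u ->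
  leb.-integrable `[0, twopi] (EFin \o (u \o @cis R)).
Proof.
move=> /integrableP[mu_ iu]; apply/integrableP; split.
  apply: (@measurable_funTS _ _ (measurableTypeR R)).
  exact: (measurableT_comp mu_ (@measurable_cis R)).
move: iu; rewrite ge0_integral_circle//; last exact: measurableT_comp.
have p0 : 0 < (twopi)^-1 by rewrite invr_gt0 two_pi_gt0.
by rewrite !ltey; apply: contra => /eqP ->; rewrite gt0_muley// lte_fin.
Qed.

Lemma Rintegral_circle (u : T -> R) : rintegrable u ->
  \int[mu]_z u z = (twopi)^-1 * \int[leb]_(t in `[0, twopi]) u (cis t).
Proof.
move=> iu; have iv := rintegrable_circle iu.
have mu_ : measurable_fun setT (EFin \o u) by move/integrableP : iu => [].
have c0 : (0 <= (twopi)^-1%:E :> \bar R)%E by rewrite lee_fin invr_ge0 ltW ?two_pi_gt0.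
apply: EFin_inj; rewrite EFinM /Rintegral !fineK; first last.
- exact: integrable_fin_num.
- exact: integrable_fin_num.
rewrite integralE [in RHS]integralE muleBr//; last exact: integrable_add_def.
rewrite (ge0_integral_circle (measurable_funepos mu_)); last by move=> z; exact: funepos_ge0.
rewrite (ge0_integral_circle (measurable_funeneg mu_)); last by move=> z; exact: funeneg_ge0.
by congr (_ * _ - _ * _)%E; apply: eq_integral => t _; rewrite !unlock.
Qed.

(** In the angular parameter, a nonconstant power of z has a periodic
antiderivative. *)
Lemma cintegral_valX (n : int) : n != 0 -> cintegral (fun z : T => val z ^ n) = 0.
Proof.
move=> n0; have nR0 : n%:~R != 0 :> R by rewrite intr_eq0.
have b (u : R -> R) (U : R -> R) : continuous u -> (forall x, is_derive (x : R) (1 : R) U (u x)) ->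
    U twopi = U 0 -> \int[leb]_(t in `[0, twopi]) u t = 0.
  move=> cu dU e; have cU x : {for x, continuous U}.
    by apply: differentiable_continuous; apply/derivable1_diffP; apply: ex_derive.
  rewrite /Rintegral (@continuous_FTC2 _ u U _ _ (two_pi_gt0 R)) ?e ?subee//.
  - by apply: continuous_subspaceT.
  - split; first by move=> x _; apply: ex_derive.
    + by apply: cvg_at_right_filter; exact: cU.
    + by apply: cvg_at_left_filter; exact: cU.
  - by move=> x _; rewrite derive1E; apply: derive_val.
have [m1 m2] : cmeasurable (fun z : T => val z ^ n) by exact: cmeasurable_valX.
have bnd (z : T) : `|complex.Re (val z ^ n)| <= 1 /\ `|complex.Im (val z ^ n)| <= 1.
  have := rnorm_sqC (val z ^ n); rewrite rnorm_valX expr1n.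
  move: (complex.Re _) (complex.Im _) => x y e.
  by rewrite !ler_norml; split; apply/andP; split; nra.
have i1 : rintegrable (cst 1 : T -> R) by exact: (@finite_measure_integrable_cst _ _ _ mu).
have cn : continuous (fun t : R => n%:~R * t).
  by move=> t; apply: cvgM; [exact: cvg_cst|exact: cvg_id].
have dn x : is_derive (x : R) (1 : R) (fun t : R => n%:~R * t) n%:~R.
  have := is_deriveZ n%:~R (is_derive_id x (1 : R)); rewrite /GRing.scale/= mulr1; apply.
have dS x : is_derive (x : R) (1 : R) (fun t => (n%:~R)^-1 * sin (n%:~R * t)) (cos (n%:~R * x)).
  have := is_deriveZ (n%:~R)^-1 (is_derive1_comp (is_derive_sin (n%:~R * x)) (dn x)).
  by rewrite /GRing.scale/= mulrCA mulVf// mulr1; apply.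
have dC x : is_derive (x : R) (1 : R) (fun t => - (n%:~R)^-1 * cos (n%:~R * t)) (sin (n%:~R * x)).
  have := is_deriveZ (- (n%:~R)^-1) (is_derive1_comp (is_derive_cos (n%:~R * x)) (dn x)).
  rewrite /GRing.scale/= (_ : - _ * (- _ * _) = sin (n%:~R * x)); first by apply.
  by field.
(* The antiderivatives take the same value at both ends of [0, 2 pi]. *)
have e2 : expi (n%:~R * twopi) = 1.
  rewrite -expi_exprz (_ : expi twopi = 1) ?exp1rz//.
  by rewrite /expi cos2pi sin2pi.
rewrite /cintegral; apply: complex_ext => /=.
  rewrite Rintegral_circle; last by apply: rintegrable_le i1 => // z; exact: (bnd z).1.
  under eq_Rintegral do rewrite expi_exprz/=.
  rewrite [X in _ * X](_ : _ = 0) ?mulr0//.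
  refine (b _ _ _ dS _).
    by move=> t; apply: continuous_comp; [exact: cn|exact: continuous_cos].
  by move: e2; rewrite /expi => -[_ ->]; rewrite !mulr0 sin0 mulr0.
rewrite Rintegral_circle; last by apply: rintegrable_le i1 => // z; exact: (bnd z).2.
under eq_Rintegral do rewrite expi_exprz/=.
rewrite [X in _ * X](_ : _ = 0) ?mulr0//.
refine (b _ _ _ dC _).
  by move=> t; apply: continuous_comp; [exact: cn|exact: continuous_sin].
by move: e2; rewrite /expi => -[-> _]; rewrite mulr0 cos0.
Qed.

End CircleIntegral.

Arguments cmeasurable_valX {R}.

(** * Integrable functions without Fourier coefficients vanish *)

Section FourierUniqueness.
Variable R : realType.
Local Notation T := (circle R).
Local Notation mu := (arc_measure R).
Local Notation leb := (@lebesgue_measure R).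
Local Notation twopi := (pi *+ 2 : R).
Implicit Types (g h : T -> R[i]) (p q u : T -> R).

Definition fourier_null g := cintegrable g /\
  forall n : int, cintegral (fun z => val z ^ n * g z) = 0.

Lemma cintegrable_cmeasurable g : cintegrable g -> cmeasurable g.
Proof.
by move=> [/integrableP[a _] /integrableP[b _]]; split; exact/measurable_EFinP.
Qed.

Lemma cintegrable_valX (n : int) g : cintegrable g -> cintegrable (fun z => val z ^ n * g z).
Proof.
move=> ig; have [m1 m2] := cmeasurableM (cmeasurable_valX n) (cintegrable_cmeasurable ig).
have [/integrable_norm a /integrable_norm b] := ig.
have bnd z : rnorm (val z ^ n * g z) <= `|complex.Re (g z)| + `|complex.Im (g z)|.
  rewrite rnormM rnorm_valX mul1r -(@ler_pXn2r _ 2)// ?nnegrE ?addr_ge0 ?rnorm_ge0//.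
  rewrite rnorm_sqC -(real_normK (num_real (complex.Re (g z)))).
  rewrite -(real_normK (num_real (complex.Im (g z)))).
  have := normr_ge0 (complex.Re (g z)); have := normr_ge0 (complex.Im (g z)).
  move: `|complex.Re _| `|complex.Im _| => x y; nra.
split; apply: rintegrable_le (rintegrableD a b) => // z.
  exact: le_trans (Re_le_rnorm _) (bnd z).
exact: le_trans (Im_le_rnorm _) (bnd z).
Qed.

Lemma fourier_nullX (m : int) g : fourier_null g -> fourier_null (fun z => val z ^ m * g z).
Proof.
move=> [ig g0]; split; first exact: cintegrable_valX.
move=> n; rewrite -[RHS](g0 (n + m)); congr cintegral; apply/funext => z.
by rewrite mulrA expfzDr// val_neq0.
Qed.

Lemma fourier_nullZ (c : R[i]) g : fourier_null g -> fourier_null (fun z => c * g z).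
Proof.
move=> [ig g0]; split; first exact: cintegrableZ.
move=> n; rewrite -[RHS](mulr0 c) -(g0 n) -cintegralZ; last exact: cintegrable_valX.
by congr cintegral; apply/funext => z; rewrite mulrCA.
Qed.

Lemma fourier_nullD g h : fourier_null g -> fourier_null h -> fourier_null (fun z => g z + h z).
Proof.
move=> [ig g0] [ih h0]; split; first exact: cintegrableD.
move=> n; rewrite -[RHS](addr0 0) -{1}(g0 n) -(h0 n) -cintegralD; try exact: cintegrable_valX.
by congr cintegral; apply/funext => z; rewrite mulrDr.
Qed.

(** The multipliers of the space of functions without Fourier coefficients form
an algebra that contains the real coordinates and is closed under bounded
pointwise limits.  Hence it contains indicators of arcs. *)
Definition multiplier p := measurable_fun setT p /\
  forall g, fourier_null g -> fourier_null (fun z => (p z)%:C%C * g z).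

Lemma dominated_vanish (p_ : nat -> T -> R) p u : (forall n, measurable_fun setT (p_ n)) ->
  (forall n z, `|p_ n z| <= 1) -> (forall z, p_ n z @[n --> \oo] --> p z) ->
  rintegrable u -> (forall n, \int[mu]_z (p_ n z * u z) = 0) ->
  rintegrable (fun z => p z * u z) /\ \int[mu]_z (p z * u z) = 0.
Proof.
move=> mp p1 cp iu p0; have /integrableP[/measurable_EFinP mu_ _] := iu.
have mpp : measurable_fun setT p by apply: measurable_fun_cvg (fun z _ => cp z).
have [] := @dominated_convergence _ _ _ mu setT measurableT
  (fun n z => (p_ n z * u z)%:E) (fun z => (p z * u z)%:E) (fun z => `|u z|%:E).
- by move=> n; apply/measurable_EFinP; exact: measurable_funM.
- by apply/measurable_EFinP; exact: measurable_funM.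
- apply: nearW => z _; apply: cvg_EFin; first by apply: nearW.
  by apply: cvgM; [exact: cp|exact: cvg_cst].
- exact: integrable_norm.
- apply: nearW => z n _ /=; rewrite lee_fin normrM.
  by rewrite -[leRHS]mul1r ler_wpM2r.
move=> ipu _ cpu; split => //.
have in_ n : rintegrable (fun z => p_ n z * u z).
  apply: rintegrable_le (integrable_norm iu); first exact: measurable_funM.
  by move=> z; rewrite normrM -[leRHS]mul1r ler_wpM2r.
rewrite /Rintegral.
have /cvg_lim <- // := cpu.
rewrite (_ : [sequence _]_n = cst 0%E); first by rewrite lim_cst.
apply/funext => n /=; have := integrable_fin_num measurableT (in_ n) => /fineK <-.
by rewrite -[fine _]/(Rintegral mu setT (fun z => p_ n z * u z)) p0.
Qed.

(** Dominated convergence, in each Fourier coefficient. *)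
Lemma multiplier_lim (p_ : nat -> T -> R) p : (forall n, multiplier (p_ n)) ->
  (forall n z, `|p_ n z| <= 1) ->
  (forall z, p_ n z @[n --> \oo] --> p z) -> multiplier p.
Proof.
move=> mp p1 cp; have mp_ n : measurable_fun setT (p_ n) by have [] := mp n.
have ReZ (r : R) (a : R[i]) : complex.Re (r%:C%C * a) = r * complex.Re a.
  by case: a => x y /=; rewrite mul0r subr0.
have ImZ (r : R) (a : R[i]) : complex.Im (r%:C%C * a) = r * complex.Im a.
  by case: a => x y /=; rewrite mul0r addr0.
split.
  by apply: measurable_fun_cvg (fun z _ => cp z).
move=> g ng.
have key (m : int) : cintegrable (fun z => (p z)%:C%C * (val z ^ m * g z)) /\
    cintegral (fun z => (p z)%:C%C * (val z ^ m * g z)) = 0.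
  have [[a b] _] := fourier_nullX m ng.
  have z0 n : cintegral (fun z => (p_ n z)%:C%C * (val z ^ m * g z)) = 0.
    have [_ /(_ _ ng)[_ /(_ m)]] := mp n => e; rewrite -[RHS]e.
    by congr cintegral; apply/funext => z; rewrite mulrCA.
  have r0 n : \int[mu]_z (p_ n z * complex.Re (val z ^ m * g z)) = 0.
    rewrite -[RHS]/(complex.Re (0 : R[i])) -(z0 n) /=.
    by apply: eq_Rintegral => z _; rewrite ReZ.
  have i0 n : \int[mu]_z (p_ n z * complex.Im (val z ^ m * g z)) = 0.
    rewrite -[RHS]/(complex.Im (0 : R[i])) -(z0 n) /=.
    by apply: eq_Rintegral => z _; rewrite ImZ.
  have [c1 c2] := dominated_vanish mp_ p1 cp a r0.
  have [d1 d2] := dominated_vanish mp_ p1 cp b i0.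
  split; first by split; [under eq_fun do rewrite ReZ|under eq_fun do rewrite ImZ].
  rewrite /cintegral; under eq_Rintegral do rewrite ReZ.
  by under [X in (_ +i* X)%C]eq_Rintegral do rewrite ImZ; rewrite c2 d2.
split.
  by have [+ _] := key 0; congr (cintegrable _); apply/funext => z; rewrite expr0z mul1r.
by move=> n; rewrite -[RHS](key n).2; congr cintegral; apply/funext => z; rewrite mulrCA.
Qed.

Lemma multiplierM p q : multiplier p -> multiplier q -> multiplier (fun z => p z * q z).
Proof.
move=> [mp Mp] [mq Mq]; split; first exact: measurable_funM.
move=> g /Mq /Mp; congr (fourier_null _); apply/funext => z.
by rewrite rmorphM/= mulrA.
Qed.

Lemma multiplier_affine (a b : R) p : multiplier p -> multiplier (fun z => a + b * p z).
Proof.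
move=> [mp Mp]; split.
  by apply: measurable_funD => //; exact: measurable_funM.
move=> g ng; have := fourier_nullD (fourier_nullZ a%:C%C ng) (fourier_nullZ b%:C%C (Mp _ ng)).
by congr (fourier_null _); apply/funext => z; rewrite rmorphD rmorphM/= mulrDl mulrA.
Qed.

(** The real part of z conj(w) is a combination of z and of its inverse, and
powers of z only move the Fourier coefficients. *)
Lemma multiplier_cos (w : R[i]) : multiplier (fun z => complex.Re (val z * Num.conj w)).
Proof.
have E (z : T) : ((complex.Re (val z * Num.conj w))%:C = 
    Num.conj w / 2 * val z ^ 1 + w / 2 * val z ^ (-1))%C.
  rewrite expr1z exprN1 -conj_val.
  rewrite [LHS]ReJ_add -[X in _ + X]/(Num.conj (val z * Num.conj w)) rmorphM/= conjCK.
  by field.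
split.
  have [+ _] := cmeasurableM (cmeasurable_valX 1) (cmeasurable_cst (Num.conj w)).
  by apply: eq_measurable_fun => z _; rewrite expr1z.
move=> g ng; have := fourier_nullD (fourier_nullZ (Num.conj w / 2) (fourier_nullX 1 ng))
  (fourier_nullZ (w / 2) (fourier_nullX (-1) ng)).
by congr (fourier_null _); apply/funext => z; rewrite E mulrDl !mulrA.
Qed.

(** This polynomial fixes 0, 1/2 and 1 and moves every other point of [0, 1] away
from 1/2, so its iterates approximate a step function. *)
Definition smoothstep (x : R) := x ^+ 2 * (3 - 2 * x).

Lemma smoothstep_itv x : 0 <= x <= 1 -> 0 <= smoothstep x <= 1.
Proof.
move=> /andP[x0 x1]; rewrite /smoothstep; apply/andP; split.
  by apply: mulr_ge0; [exact: sqr_ge0|lra].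
have := mulr_ge0 (sqr_ge0 (1 - x)) (_ : 0 <= 1 + 2 * x) => /(_ ltac:(lra)) h; nra.
Qed.

Lemma iter_smoothstep_itv n x : 0 <= x <= 1 -> 0 <= iter n smoothstep x <= 1.
Proof. by move=> hx; elim: n => //= n; exact: smoothstep_itv. Qed.

(** The ratio of smoothstep y to y is y (3 - 2 y), which increases with y up to the
value 1 at 1/2.  Along the decreasing orbit of x it stays below its first
value. *)
Lemma iter_smoothstep_lt x : 0 <= x -> x < 2^-1 -> iter n smoothstep x @[n --> \oo] --> 0.
Proof.
move=> x0 xh; pose r := x * (3 - 2 * x).
have r0 : 0 <= r by rewrite /r; nra.
have r1 : r < 1 by rewrite /r; nra.
have h n : 0 <= iter n smoothstep x <= x /\ iter n smoothstep x <= r ^+ n.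
  elim: n => [|n [/andP[a b] c]] /=; first by rewrite x0 lexx expr0; split => //; lra.
  rewrite exprS; set y := iter n _ x in a b c *.
  have e : smoothstep y <= r * y.
    rewrite /smoothstep expr2 -mulrA mulrC ler_wpM2r//.
    have : 0 <= (x - y) * (3 - 2 * (x + y)) by rewrite mulr_ge0 ?subr_ge0//; lra.
    rewrite /r; nra.
  have e0 : 0 <= smoothstep y by rewrite /smoothstep mulr_ge0 ?sqr_ge0//; lra.
  split; last by apply: le_trans e _; rewrite ler_wpM2l.
  by rewrite e0/=; apply: le_trans e _; nra.
apply: (@squeeze_cvgr _ _ _ _ (cst 0) (fun n => r ^+ n)).
- by apply: nearW => n; have [/andP[-> _] ->] := h n.
- exact: cvg_cst.
- by apply: cvg_expr; rewrite ger0_norm.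
Qed.

Lemma smoothstep_sym x : smoothstep (1 - x) = 1 - smoothstep x.
Proof. by rewrite /smoothstep; ring. Qed.

Definition smoothstep_lim (x : R) : R :=
  if x < 2^-1 then 0 else if x == 2^-1 then 2^-1 else 1.

Lemma cvg_iter_smoothstep x : 0 <= x <= 1 -> iter n smoothstep x @[n --> \oo] --> smoothstep_lim x.
Proof.
move=> /andP[x0 x1]; rewrite /smoothstep_lim; case: ltP => [|]; first exact: iter_smoothstep_lt.
case: eqVneq => [-> _|xn xh].
  rewrite (_ : (fun n => _) = cst 2^-1); first exact: cvg_cst.
  apply/funext; elim=> //= n ->; rewrite /smoothstep; by field.
have hx : 1 - x < 2^-1 by move: xn xh; rewrite le_eqVlt eq_sym => /negPf -> /=; lra.
have E n : iter n smoothstep (1 - x) = 1 - iter n smoothstep x.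
  by elim: n => //= n ->; rewrite smoothstep_sym.
rewrite (_ : (fun n => _) = (fun n => 1 - iter n smoothstep (1 - x))); last first.
  by apply/funext => n; rewrite E subKr.
rewrite -[X in _ --> X](subr0 (1 : R)); apply: cvgB; first exact: cvg_cst.
by apply: iter_smoothstep_lt => //; rewrite subr_ge0.
Qed.

(** The iterates of [smoothstep] at an affine function of Re (z conj(w)) that
equals 1/2 on the boundary of the arc converge to a function chi with values
0, 1/2 and 1; then 2 chi^2 - chi also vanishes on the boundary. *)
Lemma multiplier_arc (c : R) (w : R[i]) : `|w| = 1 -> `|c| <= 1 ->
  multiplier (fun z : T => ((c < complex.Re (val z * Num.conj w))%R)%:R).
Proof.
move=> w1 c1; pose u (z : T) := (2^-1 - c / 4) + 4^-1 * complex.Re (val z * Num.conj w).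
have u01 z : 0 <= u z <= 1.
  have : `|complex.Re (val z * Num.conj w)| <= 1.
    apply: le_trans (Re_le_rnorm _) _; rewrite rnormM rnorm_val mul1r.
    by rewrite /rnorm norm_conjC w1.
  by move: c1; rewrite /u !ler_norml => /andP[? ?] /andP[? ?]; apply/andP; split; lra.
have Ms n : multiplier (fun z => iter n smoothstep (u z)).
  elim: n => [|n ih]; first exact: multiplier_affine (multiplier_cos w).
  have := multiplierM (multiplierM ih ih) (multiplier_affine 3 (-2) ih).
  by congr multiplier; apply/funext => z /=; rewrite /smoothstep; ring.
have bd n z : `|iter n smoothstep (u z)| <= 1.
  by have /andP[a b] := iter_smoothstep_itv n (u01 z); rewrite ger0_norm.
have mc := multiplier_lim Ms bd (fun z => cvg_iter_smoothstep (u01 z)).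
have := multiplierM mc (multiplier_affine (-1) 2 mc).
congr multiplier; apply/funext => z; rewrite /smoothstep_lim.
have -> : (u z < 2^-1) = (complex.Re (val z * Num.conj w) < c).
  by rewrite /u; apply/idP/idP => ?; lra.
have -> : (u z == 2^-1) = (complex.Re (val z * Num.conj w) == c).
  by rewrite /u; apply/eqP/eqP => ?; lra.
by case: ltgtP => _ /=; lra.
Qed.

Lemma sin_ge0_pi (x : R) : 0 <= x <= pi -> 0 <= sin x.
Proof.
move=> /andP[]; rewrite le_eqVlt => /predU1P[<-|x0]; first by rewrite sin0.
rewrite le_eqVlt => /predU1P[->|xp]; first by rewrite sinpi.
by rewrite ltW// sin_gt0_pi// x0.
Qed.

(** The half-plane cuts out an arc, because
cos (s - t/2) - cos (t/2) = 2 sin (s/2) sin ((t - s)/2)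
and both half-angles lie in [- pi, pi]. *)
Lemma arc_itv (s t : R) : 0 <= s <= twopi -> 0 < t <= twopi ->
  (cos (t / 2) < complex.Re (val (cis s) * Num.conj (expi (t / 2)))) = (0 < s < t).
Proof.
move=> /andP[s0 s1] /andP[t0 t1].
have -> : complex.Re (val (cis s) * Num.conj (expi (t / 2))) =
    cos (t / 2) + 2 * (sin (s / 2) * sin ((t - s) / 2)).
  rewrite /= mulrN opprK mulrBl sinB.
  rewrite [in LHS](splitr s) cosD sinD.
  have := cos2Dsin2 (s / 2); move: (cos (s/2)) (sin (s/2)) (cos (t/2)) (sin (t/2)) => a b c e h.
  apply/eqP; rewrite -subr_eq0 (_ : _ - _ = (a ^+ 2 + b ^+ 2 - 1) * c); last by ring.
  by rewrite h subrr mul0r.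
have pi2 : pi = twopi / 2 :> R by lra.
have sS : 0 <= sin (s / 2) by apply: sin_ge0_pi; apply/andP; split; lra.
rewrite ltrDl pmulr_rgt0//.
apply/idP/idP.
  move=> h; apply/andP; split.
    rewrite lt_neqAle s0 andbT; apply: contraTneq h => <-.
    by rewrite mul0r sin0 mul0r ltxx.
  rewrite ltNge; apply/negP => ts; move: h; apply/negP; rewrite -leNgt.
  rewrite -[X in _ * X]opprK -sinN mulrN oppr_le0 mulr_ge0//.
  by apply: sin_ge0_pi; apply/andP; split; lra.
move=> /andP[sp st]; apply: mulr_gt0; apply: sin_gt0_pi; apply/andP; split; lra.
Qed.

(** Lebesgue differentiation of an indefinite integral that is constant. *)
Lemma Rintegral_itv_eq0_ae (v : R -> R) : leb.-integrable `[0, twopi] (EFin \o v) ->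
  (forall t, 0 < t <= twopi -> \int[leb]_(s in `]0, t[) v s = 0) ->
  {ae leb, forall s, s \in `[0, twopi] -> v s = 0}.
Proof.
move=> iv v0; pose f := v \_ `[0, twopi].
have iI (i : interval R) : [set` i] `<=` `[0, twopi] -> leb.-integrable [set` i] (EFin \o v).
  by move=> h; apply: integrableS iv.
have F0 y : \int[leb]_(s in `]-oo, y]) f s = 0.
  rewrite /f -Rintegral_mkcondr.
  have c t : 0 < t <= twopi -> \int[leb]_(s in `[0, t]) v s = 0.
    move=> /[dup] /andP[t0 t1] ht.
    rewrite -Rintegral_itv_obnd_cbnd; last first.
      by apply: iI => s /=; rewrite !in_itv/= => /andP[? ?]; apply/andP; split; lra.
    rewrite -Rintegral_itv_bndo_bndc; last first.
      by apply: iI => s /=; rewrite !in_itv/= => /andP[? ?]; apply/andP; split; lra.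
    exact: v0.
  have [y0|y0] := ltP y 0.
    rewrite (_ : _ `&` _ = set0) ?Rintegral_set0//.
    by apply/seteqP; split=> s //= [] /=; rewrite !in_itv/= => ? /andP[? ?]; lra.
  have [yp|yp] := leP y twopi; last first.
    rewrite (_ : _ `&` _ = `[0, twopi]%classic) ?c ?two_pi_gt0 ?lexx//.
    apply/seteqP; split=> s /=; first by move=> [].
    by move=> h; split => //; move: h; rewrite !in_itv/= => /andP[? ?]; lra.
  rewrite (_ : _ `&` _ = `[0, y]%classic).
    move: y0; rewrite le_eqVlt => /predU1P[<-|y0]; last by rewrite c// y0.
    by rewrite set_itv1 Rintegral_set1.
  apply/seteqP; split=> s /=; rewrite !in_itv/=; first by move=> [-> /andP[-> _]].
  by move=> /andP[a b]; split => //; apply/andP; split; lra.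
have iff : leb.-integrable setT (EFin \o f).
  by rewrite /f -restrict_EFin; apply/integrable_restrict => //=; rewrite setTI.
have iy y : leb.-integrable `]-oo, y] (EFin \o f) by apply: integrableS iff.
have lf : locally_integrable [set: R] f by exact: integrable_locally.
have [A [mA A0 sA]] := FTC1Ny iy lf; exists A; split => // s /= vs; apply: sA => /= -[_].
rewrite (_ : (fun x => \int[leb]_(t in `]-oo, x]) f t) = cst 0); last first.
  by apply/funext => y; exact: F0.
rewrite derive1_cst => e; apply: vs => sI; have : f s = 0 by rewrite -e.
by rewrite /f /patch mem_set.
Qed.

(** The open arc from 1 to exp (i t), cut out by the half-plane whose boundary
passes through these two points. *)
Definition arc_indic (t : R) (z : T) : R :=
  ((cos (t / 2) < complex.Re (val z * Num.conj (expi (t / 2))))%R)%:R.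

Lemma multiplier_arc_indic t : multiplier (arc_indic t).
Proof.
apply: multiplier_arc; first by apply/eqP; exact: norm_expi.
by rewrite ler_norml cos_geN1 cos_le1.
Qed.

Lemma Rintegral_arcs_eq0_ae u : rintegrable u ->
  (forall t, 0 < t <= twopi -> \int[mu]_z (arc_indic t z * u z) = 0) ->
  {ae mu, forall z, u z = 0}.
Proof.
move=> iu u0; have iv := rintegrable_circle iu.
have p0 : (twopi)^-1 != 0 :> R by rewrite invr_eq0 gt_eqF ?two_pi_gt0.
have ivv : {ae leb, forall s, s \in `[0, twopi] -> u (cis s) = 0}.
  apply: Rintegral_itv_eq0_ae iv _ => t ht.
  have hI : `]0, t[ `<=` `[0, twopi].
    by move=> s /=; rewrite !in_itv/= => /andP[? ?]; move/andP: ht => [? ?]; apply/andP; split; lra.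
  have iau : rintegrable (fun z => arc_indic t z * u z).
    apply: rintegrable_le (integrable_norm iu).
      apply: measurable_funM; first exact: (multiplier_arc_indic t).1.
      by move/integrableP : iu => [/measurable_EFinP].
    move=> z; rewrite normrM ler_piMl// /arc_indic.
    by case: (_ < _)%R; rewrite ?normr1 ?normr0.
  have := u0 t ht; rewrite (Rintegral_circle iau).
  move=> /eqP; rewrite mulf_eq0 (negPf p0) => /eqP e; apply: etrans e.
  rewrite -[in LHS](setIidl hI) Rintegral_mkcondl.
  apply: eq_Rintegral => s; rewrite inE => sI; rewrite /arc_indic arc_itv//.
  rewrite /patch mem_setE in_itv/=.
  by case: ifPn; rewrite ?mul1r ?mul0r.
have [mu_ _] := integrableP _ _ _ iu.
have /(ae_eq_integral_abs _ measurableT mu_) : (\int[mu]_z `|(EFin \o u) z| = 0)%E.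
  rewrite ge0_integral_circle//; last exact: measurableT_comp.
  have [mv _] := integrableP _ _ _ iv.
  rewrite (_ : (\int[leb]_(t in _) _)%E = 0%E) ?mule0//.
  apply/(ae_eq_integral_abs leb _ mv) => //.
  case: ivv => A [mA A0 sA]; exists A; split => // s /= h; apply: sA => /= h2; apply: h => sI.
  by rewrite /= h2.
move=> [A [mA A0 sA]]; exists A; split => // z /= uz; apply: sA => /= /(_ I)[].
exact: uz.
Qed.

(** Uniqueness of Fourier coefficients: the integral of g over an arc is the
coefficient of index 0 of the product of g by a multiplier. *)
Lemma fourier_null_ae g : fourier_null g -> {ae mu, forall z, g z = 0}.
Proof.
move=> ng; have [[iR iI] _] := ng.
have key t : fourier_null (fun z => (arc_indic t z)%:C%C * g z).
  by have [_] := multiplier_arc_indic t; apply.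
have kR : {ae mu, forall z, complex.Re (g z) = 0}.
  apply: Rintegral_arcs_eq0_ae => // t ht; have [_ /(_ 0) /(congr1 (@complex.Re R))/=] := key t.
  move=> e; rewrite -[RHS]e; apply: eq_Rintegral => z _.
  by rewrite expr0z mul1r cReM/= mul0r subr0.
have kI : {ae mu, forall z, complex.Im (g z) = 0}.
  apply: Rintegral_arcs_eq0_ae => // t ht; have [_ /(_ 0) /(congr1 (@complex.Im R))/=] := key t.
  move=> e; rewrite -[RHS]e; apply: eq_Rintegral => z _.
  by rewrite expr0z mul1r cImM/= mul0r addr0.
by apply: filterS2 kR kI => z a b; exact: complex_ext.
Qed.

End FourierUniqueness.

(** * Square-integrable functions with values in a Hilbert space *)

Section SquareIntegrable.
Variables (R : realType) (K : hilbertType R) (d : nat -> K).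
Hypothesis dd : dense_seq d.
Local Notation T := (circle R).
Local Notation mu := (arc_measure R).
Implicit Types (f g : T -> K) (V U : set (T -> K)).

(** Weak measurability passes to sums and to limits without any countability
argument. *)
Definition wmeasurable f := forall k, measurable_fun setT (fun z => complex.Re (inner (f z) k)).

Lemma wmeasurable_cmeasurable f k : wmeasurable f -> cmeasurable (fun z => inner (f z) k).
Proof.
move=> mf; split; first exact: mf.
by under eq_fun do rewrite Im_inner; exact: mf.
Qed.

Lemma wmeasurableD f g : wmeasurable f -> wmeasurable g -> wmeasurable (f + g).
Proof.
move=> mf mg k; under eq_fun do rewrite innerDl cReD.
exact: measurable_funD.
Qed.

Lemma wmeasurableM h f : cmeasurable h -> wmeasurable f -> wmeasurable (fun z => h z *: f z).
Proof.
move=> mh mf k; under eq_fun do rewrite innerZl.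
by have [] := cmeasurableM mh (wmeasurable_cmeasurable k mf).
Qed.

Lemma wmeasurable_cst k : wmeasurable (fun=> k).
Proof. by move=> ?; exact: measurable_cst. Qed.

Lemma wmeasurable_lim (f_ : nat -> T -> K) f : (forall n, wmeasurable (f_ n)) ->
  (forall z, rnorm (f_ n z - f z) @[n --> \oo] --> (0 : R)) -> wmeasurable f.
Proof.
move=> mf cf k.
apply: (@measurable_fun_cvg _ _ _ _ (fun n z => complex.Re (inner (f_ n z) k))) => [n|z _].
  exact: mf.
apply/cvgrPdist_le => e e0.
have : \forall n \near \oo, rnorm (f_ n z - f z) <= e / (rnorm k + 1).
  have /cvgrPdist_le/(_ (e / (rnorm k + 1))) := cf z.
  rewrite divr_gt0 ?ltr_wpDl ?rnorm_ge0// => /(_ isT); apply: filterS => n.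
  by rewrite sub0r normrN ger0_norm ?rnorm_ge0.
apply: filterS => n.
rewrite ler_pdivlMr ?ltr_wpDl ?rnorm_ge0// => hn.
rewrite distrC; have -> : complex.Re (inner (f_ n z) k) - complex.Re (inner (f z) k) =
  complex.Re (inner (f_ n z - f z) k).
  by rewrite innerDl innerNl; case: (inner _ _) (inner _ _) => [? ?] [].
apply: le_trans hn; apply: le_trans (Re_le_rnorm _) _.
apply: le_trans (inner_CS _ _) _.
by apply: ler_wpM2l; rewrite ?rnorm_ge0// lerDl.
Qed.

(** Outside a ball means inside one of countably many half-spaces. *)
Lemma wmeasurable_rnorm f : wmeasurable f -> measurable_fun setT (fun z => rnorm (f z)).
Proof.
move=> mf; apply: (measurability _ (RGenOInfty.measurableE R)) => //.
move=> _ [_ [a ->] <-]; rewrite setTI.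
have [a0|a0] := ltP a 0.
  rewrite [X in measurable X](_ : _ = setT)//; apply/seteqP; split => // z _ /=.
  by rewrite in_itv/= andbT (lt_le_trans a0)// rnorm_ge0.
rewrite [X in measurable X](_ : _ =
  \bigcup_n [set z | a * rnorm (d n) < complex.Re (inner (f z) (d n))]).
  apply: bigcupT_measurable => n; rewrite -[X in measurable X]setTI.
  rewrite [X in _ `&` X](_ : _ = (fun z => complex.Re (inner (f z) (d n))) @^-1`
    `]a * rnorm (d n), +oo[); first exact: mf.
  by apply/seteqP; split=> z /=; rewrite in_itv/= andbT.
apply/seteqP; split=> z /=; rewrite in_itv/= andbT.
  move=> az; apply: contrapT => h; move: az; apply/negP; rewrite -leNgt.
  apply: (rnorm_le_dense dd) => // n; rewrite leNgt; apply/negP => hn.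
  by apply: h; exists n.
move=> [n _ /=]; rewrite !ltNge; apply: contra => h.
apply: le_trans (Re_inner_le _ _) _; by rewrite ler_wpM2r ?rnorm_ge0.
Qed.

(** An open set is a countable union of balls centered on the dense sequence. *)
Lemma wmeasurable_borel f : wmeasurable f -> borel_fun f.
Proof.
move=> mf O oO.
rewrite [X in measurable X](_ : _ = \bigcup_m \bigcup_(n in
    [set n : nat | forall y, rnorm (y - d m) < n.+1%:R^-1 -> O y])
  [set z | rnorm (f z - d m) < n.+1%:R^-1]).
  apply: bigcupT_measurable => m; apply: bigcup_measurable => n _.
  have := wmeasurable_rnorm (wmeasurableD mf (wmeasurable_cst (- d m))).
  move=> /(_ measurableT `]-oo, n.+1%:R^-1[%classic (measurable_itv _)).
  rewrite setTI; congr (measurable _).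
apply/seteqP; split=> z /=; last by move=> [m _] [n /= h]; exact: h.
move=> Ofz; have := open_nbhs_nbhs (conj oO Ofz) => /nbhs_ballP[e /= e0 be].
have e0' : 0 < complex.Re e by move: e0; rewrite ltcE => /andP[].
have ee : e = (complex.Re e)%:C%C.
  by apply: complex_ext => //=; move: e0; rewrite ltcE /= => /andP[/eqP].
have [n hn] : exists n : nat, n.+1%:R^-1 < complex.Re e / 2.
  have /ltr_add_invr[n] : 0 < complex.Re e / 2 by rewrite divr_gt0.
  by rewrite add0r => h; exists n.
have [m hm] := dd (f z) (e := n.+1%:R^-1) ltac:(by rewrite invr_gt0).
exists m => //; exists n => //= y hy; apply: be; rewrite -ball_normE/= ee rnormE ltcR.
have -> : f z - y = (f z - d m) - (y - d m) by rewrite opprB addrA subrK.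
apply: le_lt_trans (rnormD _ _) _; rewrite rnormN [ltRHS]splitr.
by rewrite ltrD// (lt_trans _ hn).
Qed.

Lemma borel_wmeasurable f : borel_fun f -> wmeasurable f.
Proof.
move=> mf k; apply: (measurability _ (RGenOInfty.measurableE R)) => //.
move=> _ [_ [a ->] <-]; rewrite setTI.
rewrite [X in measurable X](_ : _ = f @^-1` [set x | a < complex.Re (inner x k)]); last first.
  by apply/seteqP; split=> z /=; rewrite in_itv/= andbT.
apply: mf; rewrite openE => x /= ax; apply/nbhs_ballP.
have k0 : 0 < rnorm k + 1 by rewrite ltr_wpDl ?rnorm_ge0.
exists ((complex.Re (inner x k) - a) / (rnorm k + 1))%:C%C => /=.
  by rewrite ltcR divr_gt0 ?subr_gt0.
move=> y; rewrite -ball_normE/= rnormE ltcR ltr_pdivlMr// => h.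
have := Re_inner_le (x - y) k.
rewrite innerDl innerNl cReD.
have -> : complex.Re (- inner y k) = - complex.Re (inner y k) by case: (inner y k).
have := rnorm_ge0 (x - y); nra.
Qed.

Lemma wmeasurable_inner f g : wmeasurable f -> wmeasurable g ->
  cmeasurable (fun z => inner (f z) (g z)).
Proof.
have hRe u v : wmeasurable u -> wmeasurable v ->
    measurable_fun setT (fun z => complex.Re (inner (u z) (v z))).
  move=> mu_ mv; rewrite (_ : (fun _ => _) =
   (fun z => 4^-1 * (rnorm ((u + v) z) ^+ 2 - rnorm ((u + (fun z => (-1) *: v z)) z) ^+ 2))).
    apply: measurable_funM => //; apply: measurable_funB;
      apply: measurable_funX; apply: wmeasurable_rnorm; apply: wmeasurableD => //.
    by apply: wmeasurableM => //; exact: cmeasurable_cst.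
  apply/funext => z; rewrite !fctE scaleN1r -polarization mulrA mulVf ?mul1r//.
move=> mf mg; split; first exact: hRe.
under eq_fun do rewrite Im_inner; apply: hRe => //.
by apply: wmeasurableM => //; exact: cmeasurable_cst.
Qed.

(** Replaces Borel measurability, which is awkward for sums, by weak
measurability. *)
Lemma L2P f : L2 f <-> wmeasurable f /\ rintegrable (fun z => rnorm (f z) ^+ 2).
Proof.
split=> [[bf fi]|[mf fi]].
  have mf := borel_wmeasurable bf; split => //; apply/integrableP; split.
    by apply/measurable_EFinP; apply: measurable_funX; exact: wmeasurable_rnorm.
  by under eq_integral do rewrite /= ger0_norm ?sqr_ge0//.
split; first exact: wmeasurable_borel.
move/integrableP : fi => [_]; congr (_ < _)%E; apply: eq_integral => z _ /=.
by rewrite ger0_norm// sqr_ge0.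
Qed.

Lemma L2_wmeasurable f : L2 f -> wmeasurable f. Proof. by move=> /L2P[]. Qed.

Lemma L2_le f (c : R) g g' : wmeasurable f -> L2 g -> L2 g' ->
  (forall z, rnorm (f z) ^+ 2 <= c * (rnorm (g z) ^+ 2 + rnorm (g' z) ^+ 2)) -> L2 f.
Proof.
move=> mf /L2P[mg ig] /L2P[mg' ig'] h; apply/L2P; split => //.
apply: (rintegrable_le _ _ (rintegrableZ c (rintegrableD ig ig'))).
  by apply: measurable_funX; exact: wmeasurable_rnorm.
by move=> z; rewrite ger0_norm ?sqr_ge0.
Qed.

Lemma L2_cst k : L2 (fun=> k : K).
Proof.
apply/L2P; split; first exact: wmeasurable_cst.
exact: (@finite_measure_integrable_cst _ _ _ mu).
Qed.

Lemma L2_0 : L2 (0 : T -> K).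
Proof. exact: (L2_cst 0). Qed.

Lemma L2D f g : L2 f -> L2 g -> L2 (f + g).
Proof.
move=> Lf Lg; apply: (L2_le (c := 2) _ Lf Lg) => [|z].
  by apply: wmeasurableD; exact: L2_wmeasurable.
have := rnormD (f z) (g z); have := rnorm_ge0 (f z + g z).
have := rnorm_ge0 (f z); have := rnorm_ge0 (g z).
rewrite -[(f + g) z]/(f z + g z).
move: (rnorm (f z + g z)) (rnorm (f z)) (rnorm (g z)) => c a b b0 a0 c0 cab.
have : c ^+ 2 <= (a + b) ^+ 2 by rewrite ler_pXn2r ?nnegrE ?addr_ge0.
have := sqr_ge0 (a - b); nra.
Qed.

Lemma L2M h f : cmeasurable h -> (forall z, rnorm (h z) <= 1) -> L2 f -> L2 (fun z => h z *: f z).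
Proof.
move=> mh h1 Lf; apply: (L2_le (c := 1) _ Lf L2_0) => [|z].
  by apply: wmeasurableM => //; exact: L2_wmeasurable.
rewrite rnorm0 expr0n/= addr0 mul1r rnormZ ler_pXn2r ?nnegrE ?mulr_ge0 ?rnorm_ge0//.
by rewrite -[leRHS]mul1r ler_wpM2r ?rnorm_ge0.
Qed.

Lemma L2Z (c : R[i]) f : L2 f -> L2 (c *: f).
Proof.
move=> Lf; apply: (L2_le (c := rnorm c ^+ 2) _ Lf L2_0) => [|z].
  by apply: wmeasurableM; [exact: cmeasurable_cst|exact: L2_wmeasurable].
by rewrite rnorm0 expr0n/= addr0 rnormZ exprMn.
Qed.

Lemma L2N f : L2 f -> L2 (- f).
Proof. by move=> /(L2Z (-1)); rewrite scaleN1r. Qed.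

Lemma L2B f g : L2 f -> L2 g -> L2 (f - g).
Proof. by move=> Lf Lg; apply: L2D => //; exact: L2N. Qed.

Lemma cintegrable_inner f g : L2 f -> L2 g -> cintegrable (fun z => inner (f z) (g z)).
Proof.
move=> /[dup] /L2_wmeasurable mf /L2P[_ ifi] /[dup] /L2_wmeasurable mg /L2P[_ ig].
have [m1 m2] := wmeasurable_inner mf mg.
have b z : rnorm (inner (f z) (g z)) <= rnorm (f z) ^+ 2 + rnorm (g z) ^+ 2.
  apply: le_trans (inner_CS _ _) _; have := sqr_ge0 (rnorm (f z) - rnorm (g z)).
  have := sqr_ge0 (rnorm (f z) + rnorm (g z)); nra.
split; apply: (rintegrable_le _ _ (rintegrableD ifi ig)) => // z.
  exact: le_trans (Re_le_rnorm _) (b z).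
apply: le_trans (b z).
rewrite -(@ler_pXn2r _ 2)// ?nnegrE ?rnorm_ge0 ?normr_ge0//.
by rewrite rnorm_sqC real_normK ?num_real// lerDr sqr_ge0.
Qed.

(** The square of the L2 norm is the quantity that is polynomial in f; the norm
itself only enters triangle inequalities and limits. *)
Definition sqnorm f : R := \int[mu]_z (rnorm (f z) ^+ 2).

Lemma l2innerC f g : L2 f -> L2 g -> l2inner g f = Num.conj (l2inner f g).
Proof.
move=> Lf Lg; rewrite /l2inner -cintegral_conj; last exact: cintegrable_inner.
by congr cintegral; apply/funext => z; exact: innerC.
Qed.

Lemma l2innerDl f g (h : T -> K) : L2 f -> L2 g -> L2 h ->
  l2inner (f + g) h = l2inner f h + l2inner g h.
Proof.
move=> Lf Lg Lh; rewrite /l2inner -cintegralD; try exact: cintegrable_inner.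
by congr cintegral; apply/funext => z; exact: innerDl.
Qed.

Lemma l2innerDr f g (h : T -> K) : L2 f -> L2 g -> L2 h ->
  l2inner h (f + g) = l2inner h f + l2inner h g.
Proof.
move=> Lf Lg Lh; rewrite l2innerC//; last exact: L2D.
by rewrite l2innerDl// rmorphD/= -!l2innerC.
Qed.

Lemma l2innerZl (c : R[i]) f (h : T -> K) : L2 f -> L2 h ->
  l2inner (c *: f) h = c * l2inner f h.
Proof.
move=> Lf Lh; rewrite /l2inner -cintegralZ; last exact: cintegrable_inner.
by congr cintegral; apply/funext => z; exact: innerZl.
Qed.

Lemma l2innerZr (c : R[i]) f (h : T -> K) : L2 f -> L2 h ->
  l2inner h (c *: f) = Num.conj c * l2inner h f.
Proof.
move=> Lf Lh; rewrite l2innerC//; last exact: L2Z.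
by rewrite l2innerZl// rmorphM/= -!l2innerC.
Qed.

Lemma l2innerNl f (h : T -> K) : L2 f -> L2 h -> l2inner (- f) h = - l2inner f h.
Proof. by move=> Lf Lh; rewrite -scaleN1r l2innerZl// mulN1r. Qed.

Lemma l2innerNr f (h : T -> K) : L2 f -> L2 h -> l2inner h (- f) = - l2inner h f.
Proof. by move=> Lf Lh; rewrite -scaleN1r l2innerZr// rmorphN1 mulN1r. Qed.

Lemma l2innerBl f g (h : T -> K) : L2 f -> L2 g -> L2 h ->
  l2inner (f - g) h = l2inner f h - l2inner g h.
Proof. by move=> *; rewrite l2innerDl ?l2innerNl//; exact: L2N. Qed.

Lemma l2innerBr f g (h : T -> K) : L2 f -> L2 g -> L2 h ->
  l2inner h (f - g) = l2inner h f - l2inner h g.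
Proof. by move=> *; rewrite l2innerDr ?l2innerNr//; exact: L2N. Qed.

Lemma l2inner_self f : l2inner f f = (sqnorm f)%:C%C.
Proof.
rewrite /l2inner /cintegral; apply: complex_ext => /=.
  by apply: eq_Rintegral => z _; rewrite inner_self.
under eq_Rintegral do rewrite inner_self/=.
by rewrite /Rintegral integral0.
Qed.

Lemma sqnorm_ge0 f : 0 <= sqnorm f.
Proof. by apply: Rintegral_ge0 => z _; rewrite sqr_ge0. Qed.

Lemma sqr_l2norm f : l2norm f ^+ 2 = sqnorm f.
Proof. by rewrite sqr_sqrtr// sqnorm_ge0. Qed.

Lemma l2norm_ge0 f : 0 <= l2norm f. Proof. exact: sqrtr_ge0. Qed.

Lemma sqnormBZ (a : R[i]) f g : L2 f -> L2 g -> sqnorm (f - a *: g) =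
  sqnorm f - 2 * complex.Re (Num.conj a * l2inner f g) + rnorm a ^+ 2 * sqnorm g.
Proof.
move=> Lf Lg; have Lag := L2Z a Lg.
apply: complexI; rewrite -l2inner_self.
rewrite !(l2innerBl, l2innerBr, l2innerZl, l2innerZr)//; try exact: L2B.
rewrite !l2inner_self (l2innerC Lf Lg); case: (l2inner f g) => u v; rewrite rnorm_sqC.
by apply: complex_ext; case: a {Lag} => b c /=; ring.
Qed.

Lemma l2inner_CS f g : L2 f -> L2 g -> rnorm (l2inner f g) ^+ 2 <= sqnorm f * sqnorm g.
Proof.
move=> Lf Lg; apply: quad_form_ge0 => [|c]; first exact: sqnorm_ge0.
by rewrite -sqnormBZ// sqnorm_ge0.
Qed.

Lemma sqnormN f : sqnorm (- f) = sqnorm f.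
Proof. by apply: eq_Rintegral => z _; rewrite -[(- f) z]/(- f z) rnormN. Qed.

Lemma sqnormB f g : L2 f -> L2 g ->
  sqnorm (f - g) = sqnorm f - 2 * complex.Re (l2inner f g) + sqnorm g.
Proof.
move=> Lf Lg; rewrite -[g in LHS]scale1r sqnormBZ// rmorph1 mul1r.
by rewrite rnormC normr1 expr1n mul1r.
Qed.

Lemma sqnormD f g : L2 f -> L2 g ->
  sqnorm (f + g) = sqnorm f + 2 * complex.Re (l2inner f g) + sqnorm g.
Proof.
move=> Lf Lg; rewrite -[g in LHS]opprK sqnormB//; last exact: L2N.
by rewrite sqnormN l2innerNr//; case: (l2inner f g) => a b /=; rewrite mulrN opprK.
Qed.

Lemma l2normN f : l2norm (- f) = l2norm f.
Proof. by rewrite /l2norm -/(sqnorm _) sqnormN. Qed.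

Lemma l2normD f g : L2 f -> L2 g -> l2norm (f + g) <= l2norm f + l2norm g.
Proof.
move=> Lf Lg; rewrite -(@ler_pXn2r _ 2)// ?nnegrE ?addr_ge0 ?l2norm_ge0//.
rewrite sqrrD !sqr_l2norm sqnormD// lerD2r lerD2l -[_ * _ *+ 2]mulr_natl ler_wpM2l//.
apply: le_trans (ler_norm _) _; apply: le_trans (Re_le_rnorm _) _.
rewrite -(@ler_pXn2r _ 2)// ?nnegrE ?mulr_ge0 ?rnorm_ge0 ?l2norm_ge0//.
by rewrite exprMn !sqr_l2norm l2inner_CS.
Qed.

Lemma sqnorm_ae f : L2 f -> {ae mu, forall z, f z = 0} -> sqnorm f = 0.
Proof.
move=> /L2P[mf ifi] f0; rewrite /sqnorm /Rintegral.
rewrite (_ : (\int[mu]_z _)%E = 0%E)//.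
rewrite -(@integral0 _ _ _ mu setT); apply: ae_eq_integral => //.
  by apply/measurable_EFinP; apply: measurable_funX; exact: wmeasurable_rnorm.
by apply: filterS f0 => z /= -> _; rewrite rnorm0 expr0n.
Qed.

Lemma sqnorm_eq0 f : L2 f -> sqnorm f = 0 -> {ae mu, forall z, f z = 0}.
Proof.
move=> /L2P[mf ifi] n0.
have mf2 : measurable_fun setT (EFin \o (fun z => rnorm (f z) ^+ 2)).
  by apply/measurable_EFinP; apply: measurable_funX; exact: wmeasurable_rnorm.
have /(ae_eq_integral_abs _ measurableT mf2) :
    (\int[mu]_z `|(EFin \o (fun z => (rnorm (f z) ^+ 2)%R)) z| = 0)%E.
  have := integrable_fin_num measurableT ifi => /fineK.
  rewrite -/(Rintegral mu setT (fun z => rnorm (f z) ^+ 2)) -/(sqnorm f) n0 => e0.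
  by apply: etrans (esym e0); apply: eq_integral => z _ /=; rewrite ger0_norm ?sqr_ge0.
apply: filterS => z /= /(_ I) [] /eqP; rewrite sqrf_eq0 => /eqP; exact: rnorm_eq0.
Qed.

Lemma l2inner_ae0 f g : L2 f -> L2 g -> sqnorm f = 0 -> l2inner f g = 0.
Proof.
move=> Lf Lg f0; apply: rnorm_eq0; apply/eqP; rewrite -sqrf_eq0 eq_le sqr_ge0 andbT.
by rewrite (le_trans (l2inner_CS Lf Lg))// f0 mul0r.
Qed.

(** * Completeness and orthogonal projections *)

Local Notation half := (2^-1 : R).

Lemma half_expS n : half ^+ n.+1 = half ^+ n / 2.
Proof. by rewrite exprSr. Qed.

Lemma half_lt (e : R) : 0 < e -> exists n, half ^+ n < e.
Proof.
have h1 : `|half| < 1 by rewrite ger0_norm ?invf_lt1 ?ltr1n.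
move=> e0; have /cvgrPdist_lt/(_ e e0)[n _ /(_ n (leqnn _))] := cvg_expr h1.
by rewrite sub0r normrN ger0_norm ?exprn_ge0// => ?; exists n.
Qed.

Lemma sqnorm0 : sqnorm (0 : T -> K) = 0.
Proof. by apply: (sqnorm_ae L2_0); exact: nearW. Qed.

Lemma l2norm0 : l2norm (0 : T -> K) = 0.
Proof. by rewrite /l2norm -/(sqnorm _) sqnorm0 sqrtr0. Qed.

Section RieszFischer.
Variable f_ : nat -> T -> K.
Hypothesis L2f : forall n, L2 (f_ n).
Hypothesis fast : forall n, l2norm (f_ n.+1 - f_ n) <= half ^+ n.

Let u n z := rnorm (f_ n.+1 z - f_ n z).
Let s z : \bar R := (\sum_(n <oo) (u n z)%:E)%E.

Let mu_ n : measurable_fun setT (u n).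
Proof. by apply: wmeasurable_rnorm; apply: L2_wmeasurable; exact: L2B. Qed.

Let integral_increment n : (\int[mu]_z (u n z)%:E <= (half ^+ n)%:E)%E.
Proof.
have [_ iu] := (L2P (f_ n.+1 - f_ n)).1 (L2B (L2f n.+1) (L2f n)).
have p0 : 0 < half ^+ n by rewrite exprn_gt0.
have i1 : rintegrable (fun z => (half ^+ n)^-1 / 2 * u n z ^+ 2 + half ^+ n / 2).
  apply: rintegrableD; first exact: rintegrableZ.
  exact: (@finite_measure_integrable_cst _ _ _ mu).
(* Since a <= (a^2/p + p)/2 for p > 0, an L2 bound by p is an L1 bound by p. *)
have ule z : u n z <= (half ^+ n)^-1 / 2 * u n z ^+ 2 + half ^+ n / 2.
  move: (half ^+ n) p0 (u n z) => p p0 a.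
  have -> : p^-1 / 2 * a ^+ 2 + p / 2 = a + (a - p) ^+ 2 * (p^-1 / 2).
    by field; rewrite gt_eqF.
  by rewrite lerDl mulr_ge0 ?sqr_ge0// mulr_ge0// invr_ge0 ltW.
have i0 : rintegrable (u n).
  by apply: rintegrable_le i1 => // z; rewrite ger0_norm ?rnorm_ge0.
apply: le_trans (le_integral measurableT i0 i1 _) _.
  by move=> z _; rewrite lee_fin.
have := integrable_fin_num measurableT i1 => /fineK <-.
rewrite lee_fin -/(Rintegral mu setT (fun z => (half ^+ n)^-1 / 2 * u n z ^+ 2 + half ^+ n / 2)).
rewrite RintegralD//; [|exact: rintegrableZ|exact: (@finite_measure_integrable_cst _ _ _ mu)].
rewrite [X in X + _]RintegralZl// [X in _ + X](_ : _ = half ^+ n / 2); last first.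
  exact: Rintegral_arc_cst.
rewrite -[X in _ * X]/(sqnorm (f_ n.+1 - f_ n)) -sqr_l2norm.
have := fast n; have := l2norm_ge0 (f_ n.+1 - f_ n).
move: (half ^+ n) p0 (l2norm _) => p p0 a a0 ap.
have : a ^+ 2 <= p ^+ 2 by rewrite ler_pXn2r ?nnegrE// ltW.
move=> h; have : p^-1 / 2 * a ^+ 2 <= p^-1 / 2 * p ^+ 2.
  by rewrite ler_wpM2l// mulr_ge0// invr_ge0 ltW.
have -> : p^-1 / 2 * p ^+ 2 = p / 2 by field; rewrite gt_eqF.
lra.
Qed.

Let sum_half n : \sum_(0 <= k < n) half ^+ k = 2 - 2 * half ^+ n.
Proof.
elim: n => [|n ih]; first by rewrite big_geq// expr0 mulr1 subrr.
by rewrite big_nat_recr//= ih half_expS; lra.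
Qed.

Let measurable_s : measurable_fun setT s.
Proof.
apply: ge0_emeasurable_sum => [k z _ _|k _]; first by rewrite lee_fin rnorm_ge0.
exact/measurable_EFinP.
Qed.

Let integral_s : (\int[mu]_z s z < +oo)%E.
Proof.
rewrite /s integral_nneseries//; first last.
- by move=> n z _; rewrite lee_fin rnorm_ge0.
- by move=> n; exact/measurable_EFinP.
apply: (@le_lt_trans _ _ (2%:E)); last exact: ltry.
apply: lime_le.
  apply: is_cvg_nneseries => n _ _; apply: integral_ge0 => z _.
  by rewrite lee_fin rnorm_ge0.
apply: nearW => n; apply: (@le_trans _ _ (\sum_(0 <= k < n) half ^+ k)%:E).
  by rewrite -sumEFin; apply: lee_sum => k _; exact: integral_increment.
by rewrite lee_fin sum_half gerBl mulr_ge0// exprn_ge0.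
Qed.

Let C := [set z | (s z < +oo)%E].

Let measurable_C : measurable C.
Proof. by rewrite -[C]setTI; exact: emeasurable_fun_infty_o. Qed.

Let aeC : {ae mu, forall z, C z}.
Proof.
have : mu.-integrable setT s.
  apply/integrableP; split => //; move: integral_s; congr (_ < _)%E.
  apply: eq_integral => z _; rewrite gee0_abs// nneseries_ge0// => n _ _.
  by rewrite lee_fin rnorm_ge0.
move=> /(integrable_ae measurableT); apply: filterS => z /(_ I).
by rewrite /C/= fin_numE => /andP[_]; rewrite ltey.
Qed.

Let Ccvg z : C z -> cvgn (f_ ^~ z).
Proof.
rewrite /C /= => sz.
have s0 : (0 <= s z)%E by rewrite nneseries_ge0// => n _ _; rewrite lee_fin rnorm_ge0.
apply: (rnorm_summable_cvg (b := fine (s z))) => n.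
rewrite -lee_fin fineK; last by rewrite ge0_fin_numE.
by rewrite -sumEFin; apply: nneseries_lim_ge => k _ _; rewrite lee_fin rnorm_ge0.
Qed.

(** Off the null set where the increments are not summable the sequence
converges pointwise, and Fatou's lemma turns this into convergence in norm. *)
Lemma fast_cauchy_cvg :
  exists2 f, L2 f & forall n, l2norm (f_ n - f) <= 2 * half ^+ n.
Proof.
(* Truncated to C, the sequence converges everywhere. *)
pose g_ n z := (\1_C z)%:C%C *: f_ n z.
have gC n z : C z -> g_ n z = f_ n z.
  by move=> Cz; rewrite /g_ indicE mem_set//= scale1r.
have gNC n z : ~ C z -> g_ n z = 0.
  by move=> Cz; rewrite /g_ indicE memNset//= scale0r.
pose f z := if z \in C then limn (f_ ^~ z) else 0.
have cf z : rnorm (g_ n z - f z) @[n --> \oo] --> (0 : R).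
  rewrite /f; case: ifPn => [|/negP zC]; rewrite ?inE.
    move=> Cz; under eq_fun do rewrite gC//; exact/cvgn_rnorm/Ccvg.
  have Cz : ~ C z by move=> Cz; apply: zC; rewrite inE.
  by under eq_fun do rewrite gNC// subr0 rnorm0; exact: cvg_cst.
have L2g n : L2 (g_ n).
  apply: L2M => //; last by move=> z; rewrite rnormC ger0_norm// ?indicE; case: (_ \in _).
  by split; [exact: measurable_indic|exact: measurable_cst].
have wf : wmeasurable f by apply: (wmeasurable_lim _ cf) => n; exact: L2_wmeasurable.
have gdist n p : l2norm (g_ (n + p)%N - g_ n) <= 2 * half ^+ n.
  apply: (@le_trans _ _ (2 * half ^+ n - 2 * half ^+ (n + p))); last first.
    by rewrite gerBl mulr_ge0// exprn_ge0.
  elim: p => [|p ih].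
    by rewrite addn0 !subrr l2norm0.
  have -> : g_ (n + p.+1)%N - g_ n = (g_ (n + p).+1 - g_ (n + p)%N) + (g_ (n + p)%N - g_ n).
    by rewrite addnS addrA subrK.
  apply: le_trans (l2normD (L2B _ _) (L2B _ _)) _ => //.
  have : l2norm (g_ (n + p).+1 - g_ (n + p)%N) <= half ^+ (n + p).
    apply: le_trans (fast _); rewrite /l2norm ler_wsqrtr//.
    have [_ i1] := (L2P (g_ (n + p).+1 - g_ (n + p)%N)).1 (L2B (L2g _) (L2g _)).
    have [_ i2] := (L2P (f_ (n + p).+1 - f_ (n + p)%N)).1 (L2B (L2f _) (L2f _)).
    apply: le_Rintegral => // z _; rewrite -![(_ - _) z]/(_ z - _ z).
    have [Cz|Cz] := pselect (C z); first by rewrite !gC.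
    by rewrite !gNC// subr0 rnorm0 expr0n/= sqr_ge0.
  rewrite addnS half_expS; lra.
have fatou n : (\int[mu]_z (rnorm ((f - g_ n) z) ^+ 2)%:E <= ((2 * half ^+ n) ^+ 2)%:E)%E.
  have mg m : measurable_fun setT (fun z => (rnorm ((g_ m - g_ n) z) ^+ 2)%:E).
    apply/measurable_EFinP; apply: measurable_funX; apply: wmeasurable_rnorm.
    by apply: L2_wmeasurable; exact: L2B.
  have := fatou mu measurableT mg _; rewrite -/(limn_einf _).
  have /[swap] /[apply] : forall m z, setT z -> (0 <= (rnorm ((g_ m - g_ n) z) ^+ 2)%:E)%E.
    by move=> m z _; rewrite lee_fin sqr_ge0.
  rewrite (_ : (\int[mu]_z _)%E = (\int[mu]_z (rnorm ((f - g_ n) z) ^+ 2)%:E)%E); last first.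
    apply: eq_integral => z _; apply: (cvg_limn_einf_sup _).1.
    apply: cvg_EFin; first by apply: nearW.
    apply: (@cvg_comp _ _ _ (fun m => rnorm ((g_ m - g_ n) z)) (fun x => x ^+ 2) _ _ _ _
      (@exprn_continuous _ 2 _)).
    apply/cvgrPdist_le => e e0.
    have /cvgrPdist_le/(_ e e0) := cf z; apply: filterS => m.
    rewrite sub0r normrN (ger0_norm (rnorm_ge0 _)) => h.
    rewrite -[(f - g_ n) z]/(f z - g_ n z) -[(g_ m - g_ n) z]/(g_ m z - g_ n z).
    have a1 := rnormD (f z - g_ n z) (g_ m z - f z).
    have a2 := rnormD (g_ m z - g_ n z) (f z - g_ m z).
    rewrite [g_ m z - g_ n z + _]addrC addrA subrK in a2.
    rewrite [f z - g_ n z + _]addrC addrA subrK in a1.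
    have := rnormN (f z - g_ m z); rewrite opprB => e1.
    by rewrite ler_norml; apply/andP; split; lra.
  move=> /le_trans; apply.
  rewrite limn_einf_lim; apply: lime_le; first exact: is_cvg_einfs.
  exists n => // m /= nm.
  apply: (@le_trans _ _ (\int[mu]_z (rnorm ((g_ m - g_ n) z) ^+ 2)%:E)%E).
    by apply: ereal_inf_lbound; exists m => /=.
  have [_ ig] := (L2P (g_ m - g_ n)).1 (L2B (L2g m) (L2g n)).
  have := integrable_fin_num measurableT ig => /fineK <-.
  rewrite lee_fin -[leLHS]/(sqnorm (g_ m - g_ n)) -sqr_l2norm.
  rewrite ler_pXn2r ?nnegrE ?l2norm_ge0 ?mulr_ge0 ?exprn_ge0//.
  by rewrite -(subnKC nm); exact: gdist.
have L2fg n : L2 (f - g_ n).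
  split; last by apply: le_lt_trans (fatou n) _; exact: ltry.
  by apply: wmeasurable_borel; apply: wmeasurableD => //; apply: L2_wmeasurable; exact: L2N.
have Lf : L2 f by rewrite -(subrK (g_ 0%N) f); exact: L2D.
exists f => // n; rewrite -(subrK (g_ n) (f_ n)) -addrA.
apply: le_trans (l2normD (L2B _ _) (L2B _ _)) _ => //.
have -> : l2norm (f_ n - g_ n) = 0.
  rewrite /l2norm -/(sqnorm _) sqnorm_ae ?sqrtr0//; first exact: L2B.
  by apply: filterS aeC => z Cz; rewrite -[LHS]/(f_ n z - g_ n z) gC// subrr.
rewrite add0r -opprB l2normN -(@ler_pXn2r _ 2) ?nnegrE ?l2norm_ge0 ?mulr_ge0 ?exprn_ge0//.
rewrite sqr_l2norm -lee_fin; apply: le_trans (fatou n).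
have [_ ig] := (L2P (f - g_ n)).1 (L2fg n).
by have := integrable_fin_num measurableT ig => /fineK <-.
Qed.

End RieszFischer.

(** The conditions of [closed_subspace] inside L2 rather than H2, because the
powers of the bilateral shift leave H2. *)
Definition l2closed (V : set (T -> K)) := [/\ V `<=` L2 (K := K), V 0,
  forall (a : R[i]) f g, V f -> V g -> V (a *: f + g) & l2closure V `<=` V].

Lemma sqnormZ (a : R[i]) f : L2 f -> sqnorm (a *: f) = rnorm a ^+ 2 * sqnorm f.
Proof.
move=> Lf; have := sqnormBZ (- a) L2_0 Lf; rewrite scaleNr sub0r opprK => ->.
by rewrite (l2inner_ae0 L2_0 Lf sqnorm0) sqnorm0 !mulr0 subr0 add0r rnormN.
Qed.

Lemma parallelogram f g : L2 f -> L2 g ->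
  sqnorm (f - g) + sqnorm (f + g) = 2 * sqnorm f + 2 * sqnorm g.
Proof. by move=> Lf Lg; rewrite sqnormB// sqnormD//; ring. Qed.

(** By the parallelogram law, a sequence that minimizes the distance to f has
small increments; the minimality of the limit in every direction is its
orthogonality. *)
Lemma projection_exists V f : l2closed V -> L2 f ->
  exists2 g, V g & forall h : T -> K, V h -> l2inner (f - g) h = 0.
Proof.
move=> [VL V0 Vlin Vcl] Lf.
pose D := [set x | exists2 g, V g & x = sqnorm (f - g)].
have D0 : has_inf D.
  by split; [exists (sqnorm (f - 0)), 0|exists 0 => _ [g _ ->]; exact: sqnorm_ge0].
pose d0 := inf D.
have d0_le g : V g -> d0 <= sqnorm (f - g).
  by move=> Vg; apply: ge_inf; [exact: D0.2|exists g].
have d0_ge0 : 0 <= d0 by apply: lb_le_inf; [exact: D0.1|move=> _ [g _ ->]; exact: sqnorm_ge0].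
(* With this margin the parallelogram law bounds the n-th increment by 2^-n. *)
have ex n : exists g, V g /\ sqnorm (f - g) < d0 + (half ^+ n / 2) ^+ 2.
  have e0 : 0 < (half ^+ n / 2) ^+ 2 by rewrite exprn_gt0// divr_gt0// exprn_gt0.
  have [_ [g Vg ->] h] := inf_adherent e0 D0.
  by exists g.
have [g_ hg] := choice ex.
have Vg n : V (g_ n) by have [] := hg n.
have Lg n : L2 (g_ n) by exact: VL.
have ng n : sqnorm (f - g_ n) < d0 + (half ^+ n / 2) ^+ 2 by have [] := hg n.
have fast n : l2norm (g_ n.+1 - g_ n) <= half ^+ n.
  rewrite -(@ler_pXn2r _ 2)// ?nnegrE ?l2norm_ge0 ?exprn_ge0// sqr_l2norm.
  have := parallelogram (L2B Lf (Lg n)) (L2B Lf (Lg n.+1)).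
  have -> : f - g_ n - (f - g_ n.+1) = g_ n.+1 - g_ n.
    by rewrite opprB addrC addrA subrK.
  have -> : f - g_ n + (f - g_ n.+1) = 2 *: (f - 2^-1 *: (g_ n + g_ n.+1)).
    by rewrite scalerBr scalerA mulfV ?pnatr_eq0// scale1r scaler_nat mulr2n opprD addrACA.
  have Vm : V (2^-1 *: (g_ n + g_ n.+1)).
    rewrite scalerDr; apply: (Vlin _ _ _ (Vg n)).
    by rewrite -[_ *: g_ n.+1]addr0; apply: Vlin.
  rewrite sqnormZ; last by apply: L2B => //; exact: VL.
  have -> : rnorm (2 : R[i]) ^+ 2 = 4.
    by rewrite -[2]/(2%:R) -(rmorph_nat (real_complex R)) rnormC ger0_norm//; lra.
  have := d0_le _ Vm; have := ng n; have := ng n.+1; rewrite half_expS.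
  have := sqnorm_ge0 (f - g_ n).
  move: (sqnorm _) (sqnorm _) (sqnorm _) (sqnorm _) (half ^+ n) => a b c e p; nra.
have [g Lgg cg] := fast_cauchy_cvg Lg fast.
have Vgg : V g.
  apply: Vcl; split => // e e0.
  have [n hn] := half_lt (divr_gt0 e0 (ltr0Sn _ 1)).
  exists (g_ n) => //; rewrite -opprB l2normN; apply: le_lt_trans (cg n) _; lra.
have gmin : sqnorm (f - g) <= d0.
  rewrite -sqr_l2norm -[leRHS]sqr_sqrtr// ler_pXn2r ?nnegrE ?l2norm_ge0 ?sqrtr_ge0//.
  apply/ler_addgt0Pr => e e0.
  have [n hn] := half_lt (divr_gt0 e0 (ltr0Sn _ 2)).
  have -> : f - g = (f - g_ n) + (g_ n - g) by rewrite addrA subrK.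
  apply: le_trans (l2normD (L2B _ _) (L2B _ _)) _ => //.
  have h1 : l2norm (f - g_ n) <= Num.sqrt d0 + half ^+ n / 2.
    have p0 : 0 <= half ^+ n / 2 by rewrite divr_ge0// exprn_ge0.
    rewrite -(@ler_pXn2r _ 2)// ?nnegrE ?addr_ge0 ?l2norm_ge0 ?sqrtr_ge0// sqr_l2norm.
    rewrite sqrrD sqr_sqrtr//; apply: le_trans (ltW (ng n)) _.
    by rewrite lerD2r lerDl mulrn_wge0// mulr_ge0// sqrtr_ge0.
  have := cg n; lra.
exists g => // h Vh; have Lh := VL _ Vh.
apply: rnorm_eq0; apply/eqP; rewrite -sqrf_eq0 eq_le sqr_ge0 andbT.
rewrite -[leRHS](mul0r (sqnorm h)); apply: quad_form_ge0 => [|c]; first exact: sqnorm_ge0.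
have := d0_le (g + c *: h) ltac:(by rewrite addrC; exact: Vlin).
rewrite opprD addrA sqnormBZ//; last exact: L2B.
lra.
Qed.

(** * Closed subspaces *)

(** A closed subspace is saturated for equality almost everywhere, since a
vanishing distance is smaller than every positive number. *)
Lemma l2closed_ae V f g : l2closed V -> L2 f -> V g -> sqnorm (f - g) = 0 -> V f.
Proof.
move=> [VL V0 Vlin Vcl] Lf Vg h; apply: Vcl; split => // e e0; exists g => //.
by rewrite /l2norm -/(sqnorm _) h sqrtr0.
Qed.

Lemma l2closedB V f g : l2closed V -> V f -> V g -> V (f - g).
Proof. by move=> [_ _ Vlin _] Vf Vg; rewrite addrC -scaleN1r; exact: Vlin. Qed.

Lemma l2inner_closure U f g : U `<=` L2 (K := K) -> L2 g ->
  (forall u, U u -> l2inner u g = 0) -> l2closure U f -> l2inner f g = 0.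
Proof.
move=> UL Lg Ug [Lf fU]; apply: rnorm_eq0; apply/eqP; rewrite eq_le rnorm_ge0 andbT.
apply/ler_addgt0Pr => e e0; rewrite add0r.
have g0 : 0 < l2norm g + 1 by rewrite ltr_wpDl ?l2norm_ge0.
have [u Uu h] := fU _ (divr_gt0 e0 g0); have Lu := UL _ Uu.
have -> : l2inner f g = l2inner (f - u) g by rewrite l2innerBl// (Ug _ Uu) subr0.
have : rnorm (l2inner (f - u) g) <= l2norm (f - u) * l2norm g.
  rewrite -(@ler_pXn2r _ 2)// ?nnegrE ?mulr_ge0 ?rnorm_ge0 ?l2norm_ge0//.
  by rewrite exprMn !sqr_l2norm l2inner_CS//; exact: L2B.
move: h; rewrite ltr_pdivlMr// => h.
have := l2norm_ge0 (f - u); have := l2norm_ge0 g; nra.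
Qed.

Lemma l2closed_L2 : l2closed (L2 (K := K)).
Proof.
split; [by []|exact: L2_0| |by move=> f []].
by move=> a f g Lf Lg; apply: L2D => //; exact: L2Z.
Qed.

Lemma l2closed_ominus V U : l2closed V -> U `<=` L2 (K := K) -> l2closed (ominus V U).
Proof.
move=> [VL V0 Vlin Vcl] UL; split.
- by move=> f [/VL].
- by split=> // g /UL Lg; exact: l2inner_ae0 L2_0 Lg sqnorm0.
- move=> a f g [Vf fU] [Vg gU]; split; first exact: Vlin.
  move=> u Uu; have [Lf Lg Lu] := And3 (VL _ Vf) (VL _ Vg) (UL _ Uu).
  by rewrite (l2innerDl (L2Z a Lf) Lg Lu) l2innerZl// fU// gU// mulr0 addr0.
- move=> f [Lf fV]; split.
    by apply: Vcl; split=> // e /fV[g [Vg _] h]; exists g.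
  move=> u Uu; apply: (@l2inner_closure (ominus V U)); [by move=> g [/VL]|exact: UL| |by split].
  by move=> g [_]; exact.
Qed.

Lemma l2closedI V U : l2closed V -> l2closed U -> l2closed (V `&` U).
Proof.
move=> [VL V0 Vlin Vcl] [UL U0 Ulin Ucl]; split.
- by move=> f [/VL].
- by [].
- by move=> a f g [Vf Uf] [Vg Ug]; split; [exact: Vlin|exact: Ulin].
- move=> f [Lf h]; split; [apply: Vcl|apply: Ucl]; split=> // e /h[g [Vg Ug] fg]; by exists g.
Qed.

(** Used for linear spans; there is no closed linear span in the ambient space of
functions, where the norm is not defined. *)
Lemma l2closed_closure U : U `<=` L2 (K := K) -> U 0 ->
  (forall (a : R[i]) f g, U f -> U g -> U (a *: f + g)) -> l2closed (l2closure U).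
Proof.
move=> UL U0 Ulin; split.
- by move=> f [].
- split; first exact: L2_0.
  by move=> e e0; exists 0 => //; rewrite subr0 l2norm0.
- move=> a f g [Lf fU] [Lg gU]; have Laf := L2Z a Lf; split; first exact: L2D.
  move=> e e0; have a0 : 0 < rnorm a + 1 by rewrite ltr_wpDl ?rnorm_ge0.
  have [u Uu hu] := fU (e / 2 / (rnorm a + 1)) ltac:(by rewrite !divr_gt0).
  have [v Uv hv] := gU (e / 2) ltac:(by rewrite divr_gt0).
  have Lu := UL _ Uu; have Lv := UL _ Uv.
  exists (a *: u + v); first exact: Ulin.
  have -> : a *: f + g - (a *: u + v) = a *: (f - u) + (g - v).
    by rewrite scalerBr opprD addrACA.
  apply: le_lt_trans (l2normD _ _) _; [by apply: L2Z; exact: L2B|exact: L2B|].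
  rewrite {1}/l2norm -/(sqnorm _) sqnormZ; last exact: L2B.
  rewrite sqrtrM ?sqr_ge0// sqrtr_sqr ger0_norm ?rnorm_ge0// -/(l2norm _).
  move: hu; rewrite ltr_pdivlMr// => hu.
  have := l2norm_ge0 (f - u); nra.
- move=> f [Lf h]; split => // e e0.
  have [g [Lg gU] fg] := h (e / 2) ltac:(by rewrite divr_gt0).
  have [u Uu gu] := gU (e / 2) ltac:(by rewrite divr_gt0).
  exists u => //; have Lu := UL _ Uu.
  rewrite (_ : f - u = (f - g) + (g - u)); last by rewrite addrA subrK.
  apply: le_lt_trans (l2normD (L2B _ _) (L2B _ _)) _ => //; lra.
Qed.

Lemma lin_span_L2 U : U `<=` L2 (K := K) -> lin_span U `<=` L2 (K := K).
Proof.
move=> UL _ [n [a [v [Uv ->]]]]; elim/big_ind: _.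
- exact: L2_0.
- by move=> f g; exact: L2D.
- by move=> i _; apply: L2Z; exact: UL.
Qed.

Lemma l2closed_span U : U `<=` L2 (K := K) -> l2closed (l2closure (lin_span U)).
Proof.
move=> UL; apply: l2closed_closure; first exact: lin_span_L2.
  by exists 0%N, (fun=> 0), (fun=> 0); split=> [[]//|]; rewrite big_ord0.
by move=> a f g; exact: lin_spanP.
Qed.

Lemma l2inner_span U f g : U `<=` L2 (K := K) -> L2 g ->
  (forall u, U u -> l2inner u g = 0) -> l2closure (lin_span U) f -> l2inner f g = 0.
Proof.
move=> UL Lg Ug; apply: l2inner_closure => //; first exact: lin_span_L2.
move=> _ [n [a [v [Uv ->]]]].
suff [] : L2 (\sum_(i < n) a i *: v i) /\ l2inner (\sum_(i < n) a i *: v i) g = 0 by [].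
elim/big_ind: _ => [|x y [Lx x0] [Ly y0]|i _].
- by split; [exact: L2_0|exact: l2inner_ae0 L2_0 Lg sqnorm0].
- by split; [exact: L2D|rewrite l2innerDl// x0 y0 addr0].
- have Lv := UL _ (Uv i); split; first exact: L2Z.
  by rewrite l2innerZl// Ug// mulr0.
Qed.

Lemma l2inner_conj0 f g : L2 f -> L2 g -> l2inner f g = 0 -> l2inner g f = 0.
Proof. by move=> Lf Lg h; rewrite l2innerC// h rmorph0. Qed.

Lemma l2inner_eql f g h : L2 f -> L2 g -> L2 h -> sqnorm (f - g) = 0 -> l2inner f h = l2inner g h.
Proof.
move=> Lf Lg Lh fg; apply/eqP; rewrite -subr_eq0 -l2innerBl//.
by rewrite (l2inner_ae0 (L2B Lf Lg) Lh fg).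
Qed.

(** * Shifts *)

(** The n-th power of the bilateral shift of L2. *)
Definition zshift (n : int) f : T -> K := fun z => val z ^ n *: f z.

Lemma zshift0 f : zshift 0 f = f.
Proof. by apply/funext => z; rewrite /zshift expr0z scale1r. Qed.

Lemma zshift_add n m f : zshift n (zshift m f) = zshift (n + m) f.
Proof. by apply/funext => z; rewrite /zshift scalerA expfzDr// val_neq0. Qed.

Lemma zshiftP n (a : R[i]) f g : zshift n (a *: f + g) = a *: zshift n f + zshift n g.
Proof.
apply/funext => z; rewrite /zshift -[(a *: f + g) z]/(a *: f z + g z).
by rewrite scalerDr scalerA mulrC -scalerA.
Qed.

Lemma zshiftB n f g : zshift n (f - g) = zshift n f - zshift n g.
Proof. by rewrite addrC -scaleN1r zshiftP scaleN1r addrC. Qed.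

Lemma L2_zshift n f : L2 f -> L2 (zshift n f).
Proof.
by move=> Lf; apply: (L2M (cmeasurable_valX n) _ Lf) => z; rewrite rnorm_valX.
Qed.

Lemma l2inner_zshift n f g : l2inner (zshift n f) g = l2inner f (zshift (- n) g).
Proof.
rewrite /l2inner; congr cintegral; apply/funext => z.
by rewrite innerZl innerZr -conj_valX conjCK.
Qed.

Lemma l2inner_zshift2 n m f g : l2inner (zshift n f) (zshift m g) = l2inner (zshift (n - m) f) g.
Proof. by rewrite !l2inner_zshift zshift_add opprB addrC. Qed.

Lemma sqnorm_zshift n f : sqnorm (zshift n f) = sqnorm f.
Proof.
by apply: eq_Rintegral => z _; rewrite rnormZ rnorm_valX mul1r.
Qed.

Lemma l2norm_zshift n f : l2norm (zshift n f) = l2norm f.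
Proof. by rewrite /l2norm -!/(sqnorm _) sqnorm_zshift. Qed.

(** A function orthogonal to every shift of each A i has scalar products with
A i that have no Fourier coefficient, hence vanish almost everywhere, outside
one null set for all i. *)
Lemma shifts_total (I : countType) (A : I -> T -> K) g : L2 g -> (forall i, L2 (A i)) ->
  {ae mu, forall z, pointwise_range A z = [set: K]} ->
  (forall n i, l2inner g (zshift n (A i)) = 0) -> sqnorm g = 0.
Proof.
move=> Lg LA Atot gA; apply: sqnorm_ae => //.
have h i : {ae mu, forall z, inner (g z) (A i z) = 0}.
  apply: fourier_null_ae; split; first exact: cintegrable_inner.
  move=> n; rewrite -[RHS](gA (- n) i) -l2inner_zshift; congr cintegral.
  by apply/funext => z; rewrite innerZl.
have h2 : {ae mu, forall z, forall n : nat, forall i, pickle i = n -> inner (g z) (A i z) = 0}.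
  apply: ae_foralln => n; case E : (pickle_inv n : option I) => [i|].
    apply: filterS (h i) => z e j jn; suff -> : j = i by [].
    by apply: Some_inj; rewrite -E -jn pickleK_inv.
  by apply: nearW => z j jn; move: E; rewrite -jn pickleK_inv.
apply: filterS2 Atot h2 => z zt gz.
have : inner (g z) (g z) = 0.
  apply: (orth_closure (S := lin_span (range (A ^~ z)))).
    by move=> x; apply: orth_lin_span => _ [i _ <-]; exact: (gz (pickle i)).
  by rewrite -/(pointwise_range A z) zt.
by rewrite inner_self => -[] /eqP; rewrite sqrf_eq0 => /eqP /rnorm_eq0.
Qed.

Lemma zshift_span n (I : Type) (F : I -> T -> K) f : (forall i, L2 (F i)) ->
  l2closure (lin_span (range F)) f ->
  l2closure (lin_span (range (fun i => zshift n (F i)))) (zshift n f).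
Proof.
move=> LF [Lf h]; split; first exact: L2_zshift.
move=> e /h[g [m [a [v [vF ->]]]] fg].
exists (zshift n (\sum_(i < m) a i *: v i)); last by rewrite -zshiftB l2norm_zshift.
exists m, a, (fun i => zshift n (v i)); split.
  by move=> i; have [j _ <-] := vF i; exists j.
apply/funext => z; rewrite /zshift !fct_sumE scaler_sumr; apply: eq_bigr => i _.
by rewrite -[(_ *: v i) z]/(a i *: v i z) scalerA mulrC -scalerA.
Qed.

(** * Orthonormal families *)

Lemma pythagoras f g : L2 f -> L2 g -> l2inner f g = 0 -> sqnorm (f + g) = sqnorm f + sqnorm g.
Proof. by move=> Lf Lg h; rewrite sqnormD// h/= mulr0 addr0. Qed.

Lemma l2inner_sumr (I : Type) (s : seq I) (a : I -> R[i]) (F : I -> T -> K) f :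
  L2 f -> (forall i, L2 (F i)) ->
  L2 (\sum_(i <- s) a i *: F i) /\
  l2inner f (\sum_(i <- s) a i *: F i) = \sum_(i <- s) Num.conj (a i) * l2inner f (F i).
Proof.
move=> Lf LF; elim: s => [|i s [ih1 ih2]].
  rewrite !big_nil; split; first exact: L2_0.
  exact: l2inner_conj0 L2_0 Lf (l2inner_ae0 L2_0 Lf sqnorm0).
rewrite !big_cons; split; first by apply: L2D ih1; exact: L2Z.
by rewrite l2innerDr//; [rewrite ih2 l2innerZr|exact: L2Z].
Qed.

Section Orthonormal.
Variables (I : choiceType) (F : I -> T -> K).
Hypothesis LF : forall i, L2 (F i).
Hypothesis oF : forall i j, l2inner (F i) (F j) = (i == j)%:R.

Definition fourier_sum f (s : seq I) := \sum_(i <- s) l2inner f (F i) *: F i.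

Lemma L2_fourier_sum f s : L2 f -> L2 (fourier_sum f s).
Proof. by move=> Lf; have [] := l2inner_sumr s (fun i => l2inner f (F i)) Lf LF. Qed.

Lemma fourier_sum_orth f s j : L2 f -> uniq s -> j \in s -> l2inner (f - fourier_sum f s) (F j) = 0.
Proof.
move=> Lf us js; have LS := L2_fourier_sum s Lf.
rewrite l2innerBl// (l2innerC (LF j) LS).
have [_ ->] := l2inner_sumr s (fun i => l2inner f (F i)) (LF j) LF.
rewrite (bigD1_seq j)//= oF eqxx mulr1 big1 ?addr0 ?conjCK ?subrr// => i ij.
by rewrite oF eq_sym (negPf ij) mulr0.
Qed.

Lemma fourier_sum_orth_span f s (n : nat) (a : 'I_n -> R[i]) (p : 'I_n -> I) : L2 f -> uniq s ->
  (forall i, p i \in s) -> l2inner (f - fourier_sum f s) (\sum_(i < n) a i *: F (p i)) = 0.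
Proof.
move=> Lf us ps; have Lr := L2B Lf (L2_fourier_sum s Lf).
have [_ ->] := l2inner_sumr (index_enum 'I_n) a Lr (fun i => LF (p i)).
by rewrite big1// => i _; rewrite fourier_sum_orth// mulr0.
Qed.

(** Pythagoras for a Fourier sum and its remainder. *)
Lemma bessel_eq f s : L2 f -> uniq s ->
  sqnorm f = sqnorm (f - fourier_sum f s) + \sum_(i <- s) rnorm (l2inner f (F i)) ^+ 2.
Proof.
move=> Lf us; have LS := L2_fourier_sum s Lf; have Lr := L2B Lf LS.
have o : l2inner (f - fourier_sum f s) (fourier_sum f s) = 0.
  have [_ ->] := l2inner_sumr s (fun i => l2inner f (F i)) Lr LF.
  by rewrite big_seq big1// => i si; rewrite fourier_sum_orth// mulr0.
have := pythagoras Lr LS o; rewrite subrK => ->; congr (_ + _).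
apply: complexI; rewrite -l2inner_self.
have -> : l2inner (fourier_sum f s) (fourier_sum f s) = l2inner f (fourier_sum f s).
  by apply/eqP; rewrite eq_sym -subr_eq0 -l2innerBl// o.
have [_ ->] := l2inner_sumr s (fun i => l2inner f (F i)) Lf LF.
rewrite rmorph_sum; apply: eq_bigr => i _; rewrite rnorm_sqC.
by case: (l2inner f (F i)) => a b; apply: complex_ext => /=; ring.
Qed.

Lemma bessel f s : L2 f -> uniq s -> \sum_(i <- s) rnorm (l2inner f (F i)) ^+ 2 <= sqnorm f.
Proof. by move=> Lf us; rewrite (bessel_eq Lf us) lerDr sqnorm_ge0. Qed.

Lemma bessel_esum f : L2 f ->
  (\esum_(i in [set: I]) (rnorm (l2inner f (F i)) ^+ 2)%:E <= (sqnorm f)%:E)%E.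
Proof.
move=> Lf; apply: ge_ereal_sup => _ [X [fX _] <-].
by rewrite fsbig_finite// sumEFin lee_fin bessel// fset_uniq.
Qed.

(** A Fourier sum is the best approximation by combinations of its terms, so its
remainder is smaller than the error of any given approximation. *)
Lemma parseval_closure f : l2closure (lin_span (range F)) f ->
  \esum_(i in [set: I]) (rnorm (l2inner f (F i)) ^+ 2)%:E = (l2norm f ^+ 2)%:E.
Proof.
move=> [Lf fV]; rewrite sqr_l2norm; apply/eqP; rewrite eq_le bessel_esum//=.
apply/lee_addgt0Pr => e e0.
(* An error below min(1, e) has its square below e. *)
have m0 : 0 < Num.min 1 e by rewrite lt_min ltr01.
have [g [n [a [v [vF gE]]]] fg] := fV _ m0.
have /choice[p hp] : forall i, exists j, F j = v i by move=> i; have [j _ <-] := vF i; exists j.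
have {}gE : g = \sum_(i < n) a i *: F (p i) by rewrite gE; apply: eq_bigr => i _; rewrite hp.
pose s := undup [seq p i | i <- index_enum 'I_n].
have us : uniq s by exact: undup_uniq.
have ps i : p i \in s by rewrite mem_undup map_f// mem_index_enum.
have LS := L2_fourier_sum s Lf.
have Lg : L2 g by rewrite gE; have [] := l2inner_sumr (index_enum 'I_n) a Lf (fun i => LF (p i)).
have le1 : sqnorm (f - fourier_sum f s) <= sqnorm (f - g).
  have o : l2inner (f - fourier_sum f s) (fourier_sum f s - g) = 0.
    rewrite (l2innerBr LS Lg (L2B Lf LS)) [X in _ - X](_ : _ = 0) ?subr0; last first.
      by rewrite gE fourier_sum_orth_span.
    have [_ ->] := l2inner_sumr s (fun i => l2inner f (F i)) (L2B Lf LS) LF.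
    by rewrite big_seq big1// => i si; rewrite fourier_sum_orth// mulr0.
  have := pythagoras (L2B Lf LS) (L2B LS Lg) o; rewrite addrA subrK => ->.
  by rewrite lerDl sqnorm_ge0.
have le2 : sqnorm (f - g) <= e.
  rewrite -sqr_l2norm; move: fg; rewrite lt_min => /andP[x1 xe].
  have := l2norm_ge0 (f - g); nra.
rewrite (bessel_eq Lf us) addrC EFinD leeD//; last by rewrite lee_fin (le_trans le1).
apply: esum_ge; exists [set` s]; first by split.
by rewrite -fsbig_seq// sumEFin.
Qed.

(** By Bessel's inequality only finitely many squared coefficients exceed
1/(n+1). *)
Lemma countable_coef f : L2 f -> countable [set j | l2inner f (F j) != 0].
Proof.
move=> Lf; rewrite (_ : [set j | _] =
  \bigcup_n [set j | n.+1%:R^-1 < rnorm (l2inner f (F j)) ^+ 2]); last first.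
  apply/seteqP; split=> j /=.
    move=> fj; have /ltr_add_invr[n] : 0 < rnorm (l2inner f (F j)) ^+ 2.
      rewrite exprn_gt0// lt_neqAle rnorm_ge0 andbT eq_sym.
      by apply: contra fj => /eqP /rnorm_eq0 ->.
    by rewrite add0r => h; exists n.
  move=> [n _ /=]; apply: contraTneq => ->.
  by rewrite rnorm0 expr0n/= -leNgt invr_ge0.
apply: bigcup_countable => // n _; apply: finite_set_countable; apply: contrapT => infX.
pose m := Num.truncn (n.+1%:R * sqnorm f).
have [X Xs Xm] := infinite_set_fset m.+1 infX.
have h1 : \sum_(i <- finmap.enum_fset X) n.+1%:R^-1 <=
    \sum_(i <- finmap.enum_fset X) rnorm (l2inner f (F i)) ^+ 2.
  by rewrite !big_seq; apply: ler_sum => i iX; apply/ltW/Xs.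
have h2 := bessel Lf (finmap.fset_uniq X).
have := le_trans h1 h2; rewrite big_const_seq count_predT iter_addr addr0 -[_ *+ size _]mulr_natl.
rewrite ler_pdivrMr// mulrC leNgt => /negP; apply.
apply: (@lt_le_trans _ _ m.+1%:R); last by rewrite ler_nat.
by rewrite -truncn_lt_nat ?mulr_ge0 ?sqnorm_ge0.
Qed.

End Orthonormal.

(** Each B j has a nonzero coefficient on some F i; otherwise it would be
orthogonal to the closed span of F, to which it belongs. *)
Lemma orthonormal_countable (J : choiceType) (B : J -> T -> K)
    (I : countType) (F : I -> T -> K) : (forall j, L2 (B j)) ->
  (forall i j, l2inner (B i) (B j) = (i == j)%:R) -> (forall i, L2 (F i)) ->
  range B `<=` l2closure (lin_span (range F)) -> countable [set: J].
Proof.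
move=> LB oB LF BF; apply: (@sub_countable _ _ _ (\bigcup_i [set j | l2inner (F i) (B j) != 0])).
  apply: subset_card_le => j _; apply: contrapT => h.
  have : l2inner (B j) (B j) = 0.
    apply: (l2inner_span (U := range F)) => //; last by apply: BF; exists j.
      by move=> _ [i _ <-].
    move=> _ [i _ <-]; apply/eqP; apply: contrapT => /negP hi; apply: h.
    by exists i.
  by rewrite oB eqxx => /eqP; rewrite oner_eq0.
by apply: bigcup_countable => // i _; exact: (countable_coef LB oB).
Qed.

(** * Constant functions and the Hardy space *)

Local Notation cstf k := (fun _ : T => k : K).

Lemma l2inner_cst k k' : l2inner (cstf k) (cstf k') = inner k k'.
Proof.
by rewrite /l2inner /cintegral !Rintegral_arc_cst; case: (inner k k').
Qed.

Lemma l2inner_zshift_cst (n : int) k k' : n != 0 -> l2inner (zshift n (cstf k)) (cstf k') = 0.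
Proof.
move=> n0; rewrite /l2inner -[RHS](mulr0 (inner k k')) -(cintegral_valX R n0) -cintegralZ.
  by congr cintegral; apply/funext => z; rewrite innerZl mulrC.
have i1 : cintegrable (fun _ : T => 1 : R[i]).
  by split; exact: (@finite_measure_integrable_cst _ _ _ mu).
by have := cintegrable_valX n i1; under eq_fun do rewrite mulr1.
Qed.

Lemma is_fourier_coefE f (n : int) c :
  is_fourier_coef f n c <-> forall k, inner c k = l2inner f (zshift n (cstf k)).
Proof.
by split=> h k; rewrite h -[X in zshift X _]opprK -l2inner_zshift.
Qed.

(** Presents H2 as an orthocomplement in L2, hence as a closed subspace. *)
Lemma H2P f : H2 K f <-> L2 f /\
  forall n : int, n < 0 -> forall k, l2inner f (zshift n (cstf k)) = 0.
Proof.
split=> -[Lf h]; split => // n n0.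
  by move=> k; have /is_fourier_coefE/(_ k) := h n n0; rewrite inner0l.
by apply/is_fourier_coefE => k; rewrite h// inner0l.
Qed.

Lemma H2_L2 : H2 K `<=` L2 (K := K). Proof. by move=> f []. Qed.

Lemma l2closed_H2 : l2closed (H2 K).
Proof.
pose U := [set g | exists n : int, n < 0 /\ exists k, g = zshift n (cstf k)].
rewrite (_ : H2 K = ominus (L2 (K := K)) U).
  apply: l2closed_ominus l2closed_L2 _ => _ [n [_ [k ->]]].
  by apply: L2_zshift; exact: L2_cst.
apply/seteqP; split=> f.
  by move=> /H2P[Lf h]; split=> // _ [n [n0 [k ->]]]; exact: h.
by move=> [Lf h]; apply/H2P; split=> // n n0 k; apply: h; exists n; split=> //; exists k.
Qed.

Lemma H2_cst k : H2 K (cstf k).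
Proof.
apply/H2P; split=> [|n n0 k']; first exact: L2_cst.
rewrite -[X in zshift X _]opprK -l2inner_zshift l2inner_zshift_cst//.
by rewrite oppr_eq0 lt_eqF.
Qed.

(** Equality almost everywhere as a vanishing norm. *)
Lemma constantsP f : constants K f <-> L2 f /\ exists k, sqnorm (f - cstf k) = 0.
Proof.
split=> [[Hf [k fk]]|[Lf [k fk]]].
  have Lf := H2_L2 Hf; split=> //; exists k; apply: sqnorm_ae; first exact: L2B Lf (L2_cst k).
  by apply: filterS fk => z e; rewrite -[LHS]/(f z - k) e subrr.
split; first exact: l2closed_ae l2closed_H2 Lf (H2_cst k) fk.
exists k; have := sqnorm_eq0 (L2B Lf (L2_cst k)) fk; apply: filterS => z.
by move=> /eqP; rewrite -[(_ - _) z]/(f z - k) subr_eq0 => /eqP.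
Qed.

Lemma constants_cst k : constants K (cstf k).
Proof. by apply/constantsP; split; [exact: L2_cst|exists k; rewrite subrr sqnorm0]. Qed.

Lemma l2norm_cst k : l2norm (cstf k) = rnorm k.
Proof.
rewrite /l2norm Rintegral_arc_cst sqrtr_sqr ger0_norm//; exact: rnorm_ge0.
Qed.

Lemma constants_zshift_orth f g (n m : int) : constants K f -> constants K g -> n != m ->
  l2inner (zshift n f) (zshift m g) = 0.
Proof.
move=> /constantsP[Lf [k fk]] /constantsP[Lg [k' gk]] nm.
rewrite l2inner_zshift2 (@l2inner_eql _ (zshift (n - m) (cstf k))) //; last first.
- by rewrite -zshiftB sqnorm_zshift.
- by apply: L2_zshift; exact: L2_cst.
- exact: L2_zshift.
have Lc : L2 (zshift (n - m) (cstf k)) by apply: L2_zshift; exact: L2_cst.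
apply: (l2inner_conj0 Lg Lc); rewrite (l2inner_eql Lg (L2_cst k') Lc gk).
apply: (l2inner_conj0 Lc (L2_cst k')).
by rewrite l2inner_zshift_cst// subr_eq0.
Qed.

(** The L2 distance of two constant functions is the distance of their values, so
constants that approximate f have values that converge in K. *)
Lemma l2closed_constants : l2closed (constants K).
Proof.
split.
- by move=> f /constantsP[].
- exact: (constants_cst 0).
- move=> a f g /constantsP[Lf [k fk]] /constantsP[Lg [k' gk]]; apply/constantsP.
  split; first by apply: L2D => //; exact: L2Z.
  exists (a *: k + k'); rewrite (_ : _ - _ = a *: (f - cstf k) + (g - cstf k')); last first.
    by apply/funext => z; rewrite !fctE scalerBr opprD addrACA.
  apply: sqnorm_ae.
    by apply: L2D; [apply: L2Z; exact: L2B Lf (L2_cst k)|exact: L2B Lg (L2_cst k')].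
  apply: filterS2 (sqnorm_eq0 (L2B Lf (L2_cst k)) fk) (sqnorm_eq0 (L2B Lg (L2_cst k')) gk) => z.
  move=> e1 e2; rewrite -[LHS]/(a *: (f - cstf k) z + (g - cstf k') z).
  by rewrite e1 e2 scaler0 addr0.
move=> f [Lf h]; apply/constantsP; split=> //.
have /choice[x hx] n : exists k, l2norm (f - cstf k) < (2^-1 : R) ^+ n.
  have [g /constantsP[Lg [k gk]] fg] := h ((2^-1 : R) ^+ n) ltac:(by rewrite exprn_gt0).
  exists k; rewrite (_ : f - cstf k = (f - g) + (g - cstf k)); last by rewrite addrA subrK.
  apply: le_lt_trans (l2normD (L2B Lf Lg) (L2B Lg (L2_cst k))) _.
  by rewrite [X in _ + X]/l2norm -/(sqnorm _) gk sqrtr0 addr0.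
have xx n : rnorm (x n.+1 - x n) <= 2 * (2^-1 : R) ^+ n.
  rewrite -l2norm_cst (_ : cstf _ = (f - cstf (x n)) - (f - cstf (x n.+1))); last first.
    by apply/funext => z; rewrite !fctE opprB addrC addrA subrK.
  apply: le_trans (l2normD (L2B Lf (L2_cst _)) (L2N (L2B Lf (L2_cst _)))) _.
  rewrite l2normN; have := hx n; have := hx n.+1; rewrite half_expS.
  have : 0 < (2^-1 : R) ^+ n by rewrite exprn_gt0.
  lra.
have sb n : \sum_(0 <= k < n) rnorm (x k.+1 - x k) <= 4.
  apply: (@le_trans _ _ (4 - 4 * (2^-1 : R) ^+ n)); last by rewrite gerBl mulr_ge0// exprn_ge0.
  elim: n => [|n ih]; first by rewrite big_geq// expr0 mulr1 subrr.
  rewrite big_nat_recr//= half_expS; have := xx n; lra.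
have xc := rnorm_summable_cvg sb.
exists (limn x); apply/eqP; rewrite -sqr_l2norm sqrf_eq0 eq_le l2norm_ge0 andbT.
apply/ler_addgt0Pr => e e0; rewrite add0r.
have e20 : 0 < e / 2 by rewrite divr_gt0.
have [n1 hn1] := half_lt e20.
have /cvgrPdist_lt/(_ _ e20)[n2 _ hn2] := cvgn_rnorm xc.
pose n := maxn n1 n2.
have h1 : l2norm (f - cstf (x n)) < e / 2.
  apply: lt_trans (hx n) _; apply: le_lt_trans hn1.
  by rewrite ler_wiXn2l ?leq_maxl// ?invr_ge0// invf_le1 ?ler1n.
have h2 : rnorm (x n - limn x) < e / 2.
  by have := hn2 n (leq_maxr _ _); rewrite sub0r normrN ger0_norm ?rnorm_ge0.
rewrite (_ : f - cstf (limn x) = (f - cstf (x n)) + cstf (x n - limn x)); last first.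
  by apply/funext => z; rewrite !fctE addrA subrK.
apply: le_trans (l2normD (L2B Lf (L2_cst _)) (L2_cst _)) _.
rewrite l2norm_cst; lra.
Qed.

(** The value of the projection on the constants is the weak integral; this
projection stands in for the Riesz representation theorem. *)
Lemma fourier_coef0P f : L2 f -> is_fourier_coef f 0 (fourier_coef f 0).
Proof.
move=> Lf; rewrite /fourier_coef; case: xgetP => [c _ //|noc].
have [g /constantsP[Lg [k gk]] fg] := projection_exists l2closed_constants Lf.
case: (noc k); apply/is_fourier_coefE => k'; rewrite zshift0.
have := fg _ (constants_cst k'); rewrite (l2innerBl Lf Lg (L2_cst k')).
move=> /eqP; rewrite subr_eq0 => /eqP ->.
by rewrite (l2inner_eql Lg (L2_cst k) (L2_cst k') gk) l2inner_cst.
Qed.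

(** * Wandering subspaces *)

Section Wandering.
Variables (A C : set (T -> K)) (J : choiceType) (B : J -> T -> K).
Variable e : nat -> int.
Hypothesis clA : l2closed A.
Hypothesis clC : l2closed C.
Hypothesis CA : C `<=` A.
Hypothesis wA : forall (n m : int) a b, A a -> A b -> n != m ->
  l2inner (zshift n a) (zshift m b) = 0.
Hypothesis bB : orthonormal_basis B (ominus A C).
Hypothesis ie : injective e.
Hypothesis tA : forall r, L2 r ->
  (forall n a, A a -> l2inner r (zshift n a) = 0) -> sqnorm r = 0.

Let LA : A `<=` L2 (K := K). Proof. by have [] := clA. Qed.

Let BA j : A (B j). Proof. by have [/(_ j)[]] := bB. Qed.

Let LB j : L2 (B j). Proof. exact: LA. Qed.

(** The remainder of the projection of f on the closed span of the [e k]-th shifts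
of B is orthogonal to all the shifts of A: f and that span are orthogonal to the
other shifts of A and to the [e k]-th shifts of C, and every element of A is the
sum of an element of C and of an element of the closed span of B. *)
Lemma wandering_parseval f : L2 f ->
  (forall k c, C c -> l2inner f (zshift (e k) c) = 0) ->
  (forall n a, (forall k, e k != n) -> A a -> l2inner f (zshift n a) = 0) ->
  \esum_(p in [set: J * nat]) (rnorm (l2inner f (zshift (e p.2) (B p.1))) ^+ 2)%:E
    = (l2norm f ^+ 2)%:E.
Proof.
move=> Lf fC fA; have [_ oB sB] := bB.
pose G (p : J * nat) := zshift (e p.2) (B p.1).
have LG p : L2 (G p) by exact: L2_zshift.
have rG : range G `<=` L2 (K := K) by move=> _ [p _ <-].
have oG p q : l2inner (G p) (G q) = (p == q)%:R.
  case: p q => [i k] [j l]; rewrite /G /= xpair_eqE.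
  have [<-|kl] := eqVneq k l; last by rewrite andbF wA//; apply: contra kl => /eqP/ie ->.
  by rewrite andbT l2inner_zshift2 subrr zshift0 oB.
apply: (parseval_closure LG oG).
have clV := l2closed_span rG; set V := l2closure _ in clV *.
have [g Vg og] := projection_exists clV Lf.
have Lg : L2 g by have [VL _ _ _] := clV; exact: VL.
apply: (l2closed_ae clV Lf Vg); apply: tA; first exact: L2B.
have VG h x : L2 x -> V h -> (forall p, l2inner (G p) x = 0) -> l2inner h x = 0.
  by move=> Lx Vh Gx; apply: (l2inner_span rG Lx _ Vh) => _ [p _ <-].
have r0 x : L2 x -> l2inner f x = 0 -> (forall p, l2inner (G p) x = 0) -> l2inner (f - g) x = 0.
  by move=> Lx fx Gx; rewrite (l2innerBl Lf Lg Lx) fx (VG g x)// subr0.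
move=> n a Aa; have La := LA Aa.
have [[k kn]|nk] := pselect (exists k, e k = n); last first.
  have {}nk k : e k != n by apply/eqP => kn; apply: nk; exists k.
  apply: r0; [exact: L2_zshift|exact: fA|].
  by move=> [j k] /=; apply: wA.
(* The component of a along C; the rest is in the closed span of B. *)
have [c Cc oc] := projection_exists clC La; have Lc := LA (CA Cc).
have wac : ominus A C (a - c) by split; [apply: l2closedB => //; exact: CA|].
rewrite -(subrK c a) -[a - c]scale1r zshiftP scale1r.
rewrite (l2innerDr (L2_zshift n (L2B La Lc)) (L2_zshift n Lc) (L2B Lf Lg)).
rewrite og ?add0r; last first.
  rewrite -kn; have [Lz hz] := zshift_span (e k) LB (sB _ wac).
  split => // eps /hz[u [m [b [v [vB ->]]]] h].
  exists (\sum_(i < m) b i *: v i) => //; exists m, b, v; split => // i.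
  by have [j _ <-] := vB i; exists (j, k).
apply: r0; [exact: L2_zshift|by rewrite -kn; exact: fC|].
move=> [j l] /=; have [<-|ln] := eqVneq (e l) n; last by apply: wA => //; exact: CA.
rewrite l2inner_zshift2 subrr zshift0.
by have [/(_ j)[_ /(_ c Cc)]] := bB.
Qed.

End Wandering.

(** * Model spaces *)

Section Model.
Variable N : set (T -> K).
Hypothesis hN : model_space N.

Let M := ominus (H2 K) N.
Let W := wandering M.

Let clN : l2closed N.
Proof.
by have [[NH N0 Nlin Ncl] _] := hN; split => // f /NH[].
Qed.

Let NL2 : N `<=` L2 (K := K). Proof. by have [] := clN. Qed.

Let NH2 : N `<=` H2 K. Proof. by have [[]] := hN. Qed.

Let clM : l2closed M. Proof. exact: l2closed_ominus l2closed_H2 NL2. Qed.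

Let ML2 : M `<=` L2 (K := K). Proof. by have [] := clM. Qed.

Lemma unilateral_shiftE f : unilateral_shift f = zshift 1 f.
Proof. by apply/funext => z; rewrite /zshift expr1z. Qed.

Lemma l2closed_wandering : l2closed W.
Proof.
apply: l2closed_ominus clM _ => _ [f Mf <-]; rewrite unilateral_shiftE.
by apply: L2_zshift; exact: ML2.
Qed.

Lemma backward_shiftE f : backward_shift f = zshift (- 1) (f - cstf (fourier_coef f 0)).
Proof. by apply/funext => z; rewrite /zshift exprN1. Qed.

(** Because z f is orthogonal to the constant that the backward shift subtracts. *)
Lemma backward_shift_adj f g : H2 K f -> H2 K g ->
  l2inner f (backward_shift g) = l2inner (zshift 1 f) g.
Proof.
move=> /H2P[Lf Hf] /H2P[Lg _]; rewrite backward_shiftE -l2inner_zshift.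
rewrite (l2innerBr Lg (L2_cst _) (L2_zshift 1 Lf)) (l2inner_zshift 1 f (cstf (fourier_coef g 0))).
by rewrite Hf ?subr0.
Qed.

Lemma H2_zshift (n : nat) f : H2 K f -> H2 K (zshift n f).
Proof.
move=> /H2P[Lf Hf]; apply/H2P; split; first exact: L2_zshift.
move=> m m0 k; rewrite l2inner_zshift zshift_add Hf//.
by rewrite addrC; lia.
Qed.

Lemma H2_backward_shift f : H2 K f -> H2 K (backward_shift f).
Proof.
move=> /H2P[Lf Hf]; set c := fourier_coef f 0.
have Lfc : L2 (f - cstf c) by apply: L2B (L2_cst c).
rewrite backward_shiftE; apply/H2P; split; first exact: L2_zshift.
move=> n n0 k; rewrite l2inner_zshift zshift_add opprK.
rewrite (l2innerBl Lf (L2_cst c)); last by apply: L2_zshift; exact: L2_cst.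
have [n1|n1] := eqVneq (1 + n) 0.
  have /is_fourier_coefE/(_ k) := fourier_coef0P Lf.
  by rewrite n1 zshift0 => <-; rewrite l2inner_cst subrr.
have n2 : 1 + n < 0 by lia.
rewrite Hf// sub0r; have /H2P[_ ->] // := H2_cst c; by rewrite oppr0.
Qed.

Lemma complement_orth f g : M f -> N g -> l2inner g f = 0.
Proof.
move=> Mf Ng; apply: l2inner_conj0; [exact: ML2|exact: NL2|].
by have [_] := Mf; apply.
Qed.

(** Invariance of the orthocomplement of N under the shift is invariance of N
under the adjoint. *)
Lemma complement_zshift (n : nat) f : M f -> M (zshift n f).
Proof.
have M1 g : M g -> M (zshift 1 g).
  move=> [Hg gN]; split; first exact: (H2_zshift 1).
  by move=> h Nh; rewrite -backward_shift_adj ?gN//; [have [_] := hN; exact|exact: NH2].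
move=> Mf; elim: n => [|n ih]; first by rewrite zshift0.
by rewrite -addn1 PoszD addrC -zshift_add; exact: M1.
Qed.

(** The remainder of the projection of f on N lies in M. *)
Lemma double_complement f : H2 K f -> (forall g, M g -> l2inner f g = 0) -> N f.
Proof.
move=> Hf fM; have Lf := H2_L2 Hf.
have [g Ng og] := projection_exists clN Lf; have Lg := NL2 Ng.
apply: (l2closed_ae clN Lf Ng).
have Mr : M (f - g).
  by split => //; apply: l2closedB Hf (NH2 Ng); exact: l2closed_H2.
have Lr := ML2 Mr; apply: complexI; rewrite -l2inner_self.
rewrite (l2innerBl Lf Lg Lr) fM// (l2inner_conj0 Lr Lg (og _ Ng)) subrr.
by rewrite rmorph0.
Qed.

Lemma wandering_zshift_orth (n m : int) f g : W f -> W g -> n != m ->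
  l2inner (zshift n f) (zshift m g) = 0.
Proof.
have WL a : W a -> L2 a by move=> [/ML2].
have key (k : nat) a b : W a -> W b -> l2inner (zshift k.+1 a) b = 0.
  move=> [Ma _] [Mb bS]; apply: l2inner_conj0; [exact: ML2|by apply: L2_zshift; exact: ML2|].
  apply: bS; exists (zshift k a); first exact: complement_zshift.
  by rewrite unilateral_shiftE zshift_add -PoszD.
move=> Wf Wg; rewrite neq_lt => /orP[nm|nm].
  apply: l2inner_conj0; try by apply: L2_zshift; exact: WL.
  have [k mn] : exists k : nat, m - n = k.+1%:Z by exists `|m - n|%N.-1; lia.
  by rewrite l2inner_zshift2 mn key.
have [k mn] : exists k : nat, n - m = k.+1%:Z by exists `|n - m|%N.-1; lia.
by rewrite l2inner_zshift2 mn key.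
Qed.

Lemma orth_projP f : L2 f ->
  N (orth_proj N f) /\ forall h : T -> K, N h -> l2inner (f - orth_proj N f) h = 0.
Proof.
move=> Lf; rewrite /orth_proj; case: xgetP => [g _ [Ng og] //|no].
by have [g Ng og] := projection_exists clN Lf; case: (no g).
Qed.

Lemma constants_orth f g (k : nat) : N f -> constants K g -> l2inner f (zshift (Negz k) g) = 0.
Proof.
move=> /NH2/H2P[Lf Hf] /constantsP[Lg [c gc]].
have Lc : L2 (zshift (Negz k) (cstf c)) by apply: L2_zshift; exact: L2_cst.
have Lz := L2_zshift (Negz k) Lg.
apply: (l2inner_conj0 Lz Lf); rewrite (l2inner_eql Lz Lc Lf); last first.
  by rewrite -zshiftB sqnorm_zshift.
by apply: (l2inner_conj0 Lf Lc); rewrite Hf.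
Qed.

(** The constants are total by separability.  An f in N is orthogonal to their
negative shifts because it is in H2, and to the nonnegative shifts of those
that lie in W because these shifts lie in M. *)
Lemma compression_parseval (J : choiceType) (e : J -> T -> K) :
  orthonormal_basis e (ominus (constants K) (W `&` constants K)) -> forall f, N f ->
  \esum_(p in [set: J * nat]) (rnorm (l2inner f (zshift p.2%:Z (e p.1))) ^+ 2)%:E
    = (l2norm f ^+ 2)%:E.
Proof.
move=> be f Nf; have Lf := NL2 Nf.
apply: (@wandering_parseval (constants K) (W `&` constants K) J e Posz).
- exact: l2closed_constants.
- exact: l2closedI l2closed_wandering l2closed_constants.
- by move=> g [].
- by move=> n m a b; exact: constants_zshift_orth.
- exact: be.
- by move=> ? ? [].
- move=> r Lr rC; apply: (@shifts_total nat (fun n => cstf (d n))).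
  + exact: Lr.
  + by move=> n; exact: L2_cst.
  + apply: nearW => z; apply/seteqP; split => // x _ B /nbhs_ballP[eps /= e0 be'].
    have e0' : 0 < complex.Re eps by move: e0; rewrite ltcE => /andP[].
    have ee : eps = (complex.Re eps)%:C%C.
      by apply: complex_ext => //=; move: e0; rewrite ltcE /= => /andP[/eqP].
    have [n xn] := dd x e0'; exists (d n); split.
      by apply: lin_span_sub; exists n.
    by apply: be'; rewrite -ball_normE/= ee rnormE ltcR.
  + by move=> n i; apply: rC; exact: constants_cst.
- exact: Lf.
- move=> k c [[Mc _] _]; apply: complement_orth Nf; exact: complement_zshift.
- case=> n a nk Ca; first by have := nk n; rewrite eqxx.
  exact: constants_orth.
Qed.

(** W is total because M is full range.  An f in N is orthogonal to the
nonnegative shifts of W, which lie in M, and to the negative shifts of the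
constants because it is in H2.  The exponents that remain are those of the form
Negz n, that is, -(n+1). *)
Lemma backward_parseval (J : choiceType) (E : J -> T -> K) : full_range M ->
  orthonormal_basis E (ominus W (W `&` constants K)) -> forall f, N f ->
  \esum_(p in [set: J * nat]) (rnorm (l2inner f (zshift (Negz p.2) (E p.1))) ^+ 2)%:E
    = (l2norm f ^+ 2)%:E.
Proof.
move=> [I [F [[WF _ _] totF]]] bE f Nf; have Lf := NL2 Nf.
apply: (@wandering_parseval W (W `&` constants K) J E Negz).
- exact: l2closed_wandering.
- exact: l2closedI l2closed_wandering l2closed_constants.
- by move=> g [].
- by move=> n m a b; exact: wandering_zshift_orth.
- exact: bE.
- by move=> ? ? [].
- move=> r Lr rW; apply: (@shifts_total I F).
  + exact: Lr.
  + by move=> i; have [/ML2] := WF i.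
  + exact: totF.
  + by move=> n i; apply: rW; exact: WF.
- exact: Lf.
- by move=> k c [_ Cc]; exact: constants_orth.
- case=> n a nk [Ma _]; first by apply: complement_orth Nf; exact: complement_zshift.
  by have := nk n; rewrite eqxx.
Qed.

(** Modulo the orthocomplement of N, which the shift preserves, projecting before
or after a shift makes no difference. *)
Lemma iter_compressionP (n : nat) g : constants K g ->
  let y := iter n (compression N) (orth_proj N g) in
  N y /\ forall f, N f -> l2inner (zshift n g - y) f = 0.
Proof.
move=> [Hg _]; elim: n => [|n [Ny oy]].
  by rewrite zshift0; apply: orth_projP; exact: H2_L2.
set y := iter n _ _ in Ny oy *; have Hy := NH2 Ny.
have Ly1 := L2_zshift 1 (NL2 Ny).
have [Ny' oy'] := orth_projP Ly1.
rewrite iterS -/y /compression unilateral_shiftE; split => // f Nf.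
have Hr : H2 K (zshift n g - y) by apply: l2closedB l2closed_H2 (H2_zshift n Hg) Hy.
have -> : zshift n.+1 g - orth_proj N (zshift 1 y) =
    zshift 1 (zshift n g - y) + (zshift 1 y - orth_proj N (zshift 1 y)).
  by rewrite zshiftB zshift_add -PoszD addrA subrK.
rewrite l2innerDl ?oy'//; last exact: NL2.
- rewrite addr0 -backward_shift_adj//; last exact: NH2.
  by apply: oy; have [_] := hN; apply.
- by apply: L2_zshift; exact: H2_L2.
- by apply: L2B => //; exact: NL2.
Qed.

Lemma iter_backward_shift_adj (n : nat) f g : H2 K f -> H2 K g ->
  l2inner f (iter n (@backward_shift R K) g) = l2inner (zshift n f) g.
Proof.
elim: n f => [|n ih] f Hf Hg; first by rewrite zshift0.
have Hn : H2 K (iter n (@backward_shift R K) g).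
  by elim: (n) => //= m; exact: H2_backward_shift.
rewrite iterS backward_shift_adj// ih//; last exact: (H2_zshift 1).
by rewrite zshift_add -PoszD addn1.
Qed.

Lemma model_frames (J : choiceType) (E e : J -> T -> K) : full_range M ->
  orthonormal_basis E (ominus W (W `&` constants K)) ->
  orthonormal_basis e (ominus (constants K) (W `&` constants K)) ->
  parseval_frame
    (fun p : J * nat => iter p.2 (compression N) (orth_proj N (e p.1))) N /\
  parseval_frame
    (fun p : J * nat => iter p.2 (@backward_shift R K) (backward_shift (E p.1))) N.
Proof.
move=> fM bE be; have [hE oE _] := bE; have [he _ _] := be.
have cJ : countable [set: J * nat].
  rewrite -setXTT; apply: countableX => //.
  have [I [F [[WF _ sF] _]]] := fM.
  apply: (@orthonormal_countable J E I F).
  - by move=> j; have [[/ML2]] := hE j.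
  - exact: oE.
  - by move=> i; have [/ML2] := WF i.
  - by move=> _ [j _ <-]; apply: sF; have [] := hE j.
split; split => //.
- by move=> [j n]; have [] := iter_compressionP n (he j).1.
- move=> f Nf; rewrite -(compression_parseval be Nf); apply: eq_esum => -[j n] _ /=.
  have [Hj _] := (he j).1.
  have [Ny oy] := iter_compressionP n (he j).1.
  have Lf := NL2 Nf; have Ly := NL2 Ny; have Lz := L2_zshift n (H2_L2 Hj).
  have := l2inner_conj0 (L2B Lz Ly) Lf (oy f Nf); rewrite (l2innerBr Lz Ly Lf).
  by move=> /eqP; rewrite subr_eq0 => /eqP ->.
- have NS g : N g -> N (backward_shift g) by have [_] := hN; apply.
  move=> [j n] /=; elim: n => [|n ih] /=; last exact: NS.
  have [[[Hj _] Wj] _] := hE j; apply: double_complement; first exact: H2_backward_shift.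
  move=> g Mg; have [Hg _] := Mg.
  apply: l2inner_conj0; [exact: ML2|by apply: H2_L2; exact: H2_backward_shift|].
  rewrite backward_shift_adj//; apply: l2inner_conj0.
  + exact: H2_L2.
  + by apply: L2_zshift; exact: ML2.
  + by apply: Wj; exists g => //; rewrite unilateral_shiftE.
- move=> f Nf; rewrite -(backward_parseval fM bE Nf); apply: eq_esum => -[j n] _ /=.
  have [[[Hj _] _] _] := hE j; have Hf := NH2 Nf.
  rewrite -iterSr iter_backward_shift_adj// l2inner_zshift.
  by rewrite NegzE.
Qed.

End Model.
End SquareIntegrable.

Theorem proposition6p3 (R : realType) (K : hilbertType R) (hK : separable_space K)
    (N : set (circle R -> K)) (hN : model_space N)
    (hfull : full_range (ominus (H2 K) N))
    (J : choiceType) (E e : J -> circle R -> K)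
    (hE : let W := wandering (ominus (H2 K) N) in
          orthonormal_basis E (ominus W (W `&` constants K)))
    (he : let W := wandering (ominus (H2 K) N) in
          orthonormal_basis e (ominus (constants K) (W `&` constants K))) :
  parseval_frame
    (fun p : J * nat => iter p.2 (compression N) (orth_proj N (e p.1))) N /\
  parseval_frame
    (fun p : J * nat => iter p.2 (@backward_shift R K) (backward_shift (E p.1))) N.
Proof. have [d dd] := separable_dense_seq hK; exact: (model_frames dd). Qed.
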